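(* Subsets of $\mathbb R^2$ are given the Euclidean ($\ell_2$) metric. (i) For $X$ a finite set of uniformly spaced points on the unit circle $S^1\subset\mathbb R^2$, any simplicial model of $\mathcal{SR}(X)$ has size exponential in $|X|$; that is, there are constants $c>0$ and $n_0$ such that for every $n\ge n_0$, if $X$ consists of $n$ uniformly spaced points on $S^1$, then every finitely presented simplicial model of $\mathcal{SR}(X)$ has size at least $\exp(cn)$. (ii) Let $X$ be a finite i.i.d. sample of the uniform distribution on the unit square $[0,1]^2$. There exists a constant $C>0$ such that for any simplicial model $\mathcal F(X)$ of $\mathcal{SR}(X)$ (finitely presented, so that its size is defined), $$\Pr\left[\text{size of }\mathcal F(X)\text{ is at least }\exp\left(C|X|^{1/3}\right)\right]\to 1\quad\text{as }|X|\to\infty .$$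
   Context: Conventions: $\mathbb N=\{1,2,\dots\}$. $\mathbf{Simp}$ is the category of finite abstract simplicial complexes and simplicial maps, regarded as a subcategory of topological spaces $\mathbf{Top}$ via geometric realization. Posets are regarded as categories; products carry the product order. Rips filtration: For a finite metric space $X$ and $r\ge0$, $\mathcal R(X)_r$ is the simplicial complex on vertex set $X$ whose simplices are the nonempty subsets all of whose pairwise distances are at most $2r$. This gives a filtration $\mathcal R(X)\colon[0,\infty)\to\mathbf{Simp}$. Subdivision-Rips: For a simplicial complex $W$ and $k\in\mathbb N$, $\mathcal S(W)_k$ is the subcomplex of the barycentric subdivision of $W$ (whose simplices are the flags $\sigma_1\subset\cdots\subset\sigma_m$ of simplices of $W$) consisting of the flags whose minimum element has dimension at least $k-1$. $\mathcal{SR}(X)\colon\mathbb N^{\mathrm{op}}\times[0,\infty)\to\mathbf{Simp}$ is $\mathcal{SR}(X)_{k,r}=\mathcal S(\mathcal R(X)_r)_k$, with inclusions as structure maps. Models: Two functors $P\to\mathbf{Top}$ are weakly equivalent if they are connected by a finite zigzag of natural transformations all of whose components are homotopy equivalences. A simplicial model of $\mathcal G\colon P\to\mathbf{Top}$ is a functor $P\to\mathbf{Simp}$ weakly equivalent to $\mathcal G$. Size: Fix a field $\mathbb K$. A persistence module over a poset $P$ is a functor $M\colon P\to\mathbf{Vec}_{\mathbb K}$. For $p\in P$ let $\mathbb K^{\langle p\rangle}$ be the module equal to $\mathbb K$ at all $x\ge p$ and $0$ elsewhere, with identity structure maps between the copies of $\mathbb K$; free modules are those isomorphic to direct sums of such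 modules. $M$ is finitely presented if it is the cokernel of a morphism between finitely generated free modules. If $P$ is a finite product of totally ordered sets, a finitely presented $M$ has a minimal free resolution $F_\bullet$ (one isomorphic to a direct summand of every free resolution), unique up to isomorphism, with each $F_i$ finitely generated; $\beta_i(M)$ is the cardinality of a minimal generating set of $F_i$. For $\mathcal G\colon P\to\mathbf{Simp}$, $C_j\mathcal G$ is the module $p\mapsto C_j(\mathcal G_p;\mathbb K)$ of simplicial $j$-chains; $\mathcal G$ is finitely presented if every $C_j\mathcal G$ is, and its size is then $\beta_1(C_0\mathcal G)+\sum_{j\ge0}\beta_0(C_j\mathcal G)$. *)

(* Defs.v *)
From HB Require Import structures.
From mathcomp Require Import all_boot all_order all_algebra perm finmap.
From mathcomp Require Import interval_inference ring lra.
From mathcomp Require Import all_classical all_reals all_analysis.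
From Stdlib Require Import Relation_Operators.

Set Implicit Arguments.
Unset Strict Implicit.
Unset Printing Implicit Defensive.

Import Order.TTheory GRing.Theory Num.Theory.
Import numFieldNormedType.Exports.

Local Open Scope ring_scope.

(* Every vertex spans a simplex; the vertex set may be empty. *)
Record scomplex := SComplex {
  vertex : finType ;
  simplex : {set {set vertex}} ;
  simplex0 : finset.set0 \notin simplex ;
  simplex1 : forall v : vertex, [set v]%SET \in simplex ;
  simplexS : forall s t : {set vertex},
    s \in simplex -> t \subset s -> t != finset.set0 -> t \in simplex }.

Record smap (A B : scomplex) := SMap {
  smap_fun :> vertex A -> vertex B ;
  smapP : forall s, s \in simplex A -> (smap_fun @: s)%SET \in simplex B }.

Record sfunctor (d : Order.disp_t) (P : porderType d) := SFunctor {
  sf_obj :> P -> scomplex ;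
  sf_map : forall p q : P, (p <= q)%O -> smap (sf_obj p) (sf_obj q) ;
  sf_id : forall (p : P) (h : (p <= p)%O) v, sf_map h v = v ;
  sf_comp : forall (p q r : P) (hpq : (p <= q)%O) (hqr : (q <= r)%O)
      (hpr : (p <= r)%O) v,
    sf_map hpr v = sf_map hqr (sf_map hpq v) }.

Record tfunctor (d : Order.disp_t) (P : porderType d) := TFunctor {
  tf_obj :> P -> topologicalType ;
  tf_map : forall p q : P, (p <= q)%O -> tf_obj p -> tf_obj q ;
  tf_cont : forall (p q : P) (h : (p <= q)%O), continuous (tf_map h) ;
  tf_id : forall (p : P) (h : (p <= p)%O) x, tf_map h x = x ;
  tf_comp : forall (p q r : P) (hpq : (p <= q)%O) (hqr : (q <= r)%O)
      (hpr : (p <= r)%O) x,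
    tf_map hpr x = tf_map hqr (tf_map hpq x) }.

Record tnat (d : Order.disp_t) (P : porderType d) (F G : tfunctor P) := TNat {
  tn_map : forall p : P, F p -> G p ;
  tn_cont : forall p : P, continuous (@tn_map p) ;
  tn_nat : forall (p q : P) (h : (p <= q)%O) x,
    tn_map (tf_map h x) = tf_map h (tn_map x) }.

Section Homotopy.
Variable R : realType.
Local Open Scope classical_set_scope.

(* The values of [H] outside the cylinder X x [0, 1] are irrelevant. *)
Definition homotopic (X Y : topologicalType) (f g : X -> Y) : Prop :=
  exists H : X * R -> Y,
    [/\ {within [set: X] `*` `[0, 1], continuous H},
        forall x, H (x, 0) = f x
      & forall x, H (x, 1) = g x].

Definition homotopy_equivalence (X Y : topologicalType) (f : X -> Y) : Prop :=
  continuous f /\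
  exists g : Y -> X,
    [/\ continuous g, homotopic (g \o f) id & homotopic (f \o g) id].

Definition objectwise_equivalence (d : Order.disp_t) (P : porderType d)
    (F G : tfunctor P) : Prop :=
  exists eta : tnat F G,
    forall p : P, homotopy_equivalence (@tn_map _ _ _ _ eta p).

(* The reflexive-symmetric-transitive closure consists of the finite zigzags. *)
Definition weakly_equivalent (d : Order.disp_t) (P : porderType d) :
    tfunctor P -> tfunctor P -> Prop :=
  clos_refl_sym_trans _ (@objectwise_equivalence d P).

End Homotopy.

Lemma ptws_continuous (T U : topologicalType) (V : Type)
    (f : T -> {ptws V -> U}) :
  (forall v, continuous (fun x => f x v)) -> continuous f.
Proof.
move=> cf x.
apply/(@cvg_sup _ _ _ _ (f x) (fmap_filter f (nbhs_filter x))) => v.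
apply: (@continuous_comp_initial _ T U (fun g : V -> U => g v) f) => y.
exact: cf.
Qed.

Section Realization.
Variable R : realType.

(* Barycentric coordinates, with the topology induced by R^V. *)
Definition realization_set (A : scomplex) :
    set {ptws vertex A -> R} :=
  fun x => [/\ forall v, 0 <= x v, \sum_v x v = 1
             & [set v | x v != 0]%SET \in simplex A].

Definition realization (A : scomplex) : topologicalType :=
  set_type (realization_set (A := A)).

Definition push_coord (A B : scomplex) (f : smap A B)
    (x : {ptws vertex A -> R}) : {ptws vertex B -> R} :=
  fun w => \sum_(v | f v == w) x v.

Lemma push_coordP (A B : scomplex) (f : smap A B) (x : realization A) :
  push_coord f (set_val x) \in realization_set (A := B).
Proof.
have [x0 x1 xs] := set_valP x; rewrite in_setE; split.
- by move=> w; apply: sumr_ge0 => v _; exact: x0.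
- rewrite -x1 [RHS](partition_big f xpredT) //; exact: eq_bigr.
- have -> : [set w | push_coord f (set_val x) w != 0]%SET
          = (f @: [set v | set_val x v != 0])%SET; last exact: smapP.
  have xw w : forall v, f v == w -> 0 <= set_val x v by move=> v _; exact: x0.
  apply/setP => w; rewrite inE /push_coord (psumr_neq0 _ (xw w)).
  apply/hasP/imsetP.
    by move=> [v _ /andP[/eqP <- xv]]; exists v => //; rewrite inE gt_eqF.
  case=> v; rewrite inE => xv ->; exists v; first exact: mem_index_enum.
  by rewrite eqxx lt_def xv x0.
Qed.

Definition realization_map (A B : scomplex) (f : smap A B)
    (x : realization A) : realization B :=
  exist _ (push_coord f (set_val x)) (push_coordP f x).

Lemma realization_map_continuous (A B : scomplex) (f : smap A B) :
  continuous (realization_map f).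
Proof.
apply: continuous_comp_initial; apply: ptws_continuous => w.
apply: (@continuous_big R _ _ 0 _ add_continuous) => v _ x.
have cval : continuous (set_val : realization A -> {ptws vertex A -> R}).
  exact: initial_continuous.
exact: (continuous_comp (cval x)
  (@proj_continuous (vertex A) (fun=> R) v (set_val x))).
Qed.

Variables (d : Order.disp_t) (P : porderType d) (G : sfunctor P).

Lemma realization_map_id (p : P) (h : (p <= p)%O) x :
  realization_map (sf_map G h) x = x.
Proof.
apply: val_inj; apply/funext => w /=; rewrite /push_coord.
by under eq_bigl do rewrite sf_id; rewrite big_pred1_eq.
Qed.

Lemma realization_map_comp (p q r : P) (hpq : (p <= q)%O) (hqr : (q <= r)%O)
    (hpr : (p <= r)%O) x :
  realization_map (sf_map G hpr) x =
  realization_map (sf_map G hqr) (realization_map (sf_map G hpq) x).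
Proof.
apply: val_inj; apply/funext => w /=; rewrite /push_coord /=.
rewrite (partition_big (sf_map G hpq) (fun u => sf_map G hqr u == w)) /=.
  apply: eq_bigr => u /eqP uw; apply: eq_bigl => v.
  rewrite (sf_comp hpq hqr) andbC.
  by case: (sf_map G hpq v =P u) => // ->; rewrite uw eqxx.
by move=> v; rewrite (sf_comp hpq hqr).
Qed.

Definition realization_functor : tfunctor P :=
  @TFunctor d P (fun p => realization (G p))
    (fun p q h => realization_map (sf_map G h))
    (fun p q h => @realization_map_continuous _ _ (sf_map G h))
    realization_map_id realization_map_comp.

End Realization.

Definition simplicial_model (R : realType) (d : Order.disp_t) (P : porderType d)
    (G : sfunctor P) (T : tfunctor P) : Prop :=
  weakly_equivalent R (realization_functor R G) T.

Record finite_metric_space (R : realType) := FiniteMetricSpace {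
  ms_point :> finType ;
  dist : ms_point -> ms_point -> R ;
  dist_eq0 : forall x y, (dist x y == 0) = (x == y) ;
  dist_sym : forall x y, dist x y = dist y x ;
  dist_triangle : forall x y z, dist x z <= dist x y + dist y z }.

Section Rips.
Variables (R : realType) (X : finite_metric_space R).

Definition rips_simplex (r : {nonneg R}) : {set {set X}} :=
  [set s | (s != finset.set0) &&
           [forall x in s, forall y in s, dist x y <= 2 * r%:num]]%SET.

Lemma rips_simplex0 r : finset.set0 \notin rips_simplex r.
Proof. by rewrite inE eqxx. Qed.

Lemma rips_simplex1 r (v : X) : [set v]%SET \in rips_simplex r.
Proof.
rewrite inE; apply/andP; split; first by apply/set0Pn; exists v; rewrite inE.
apply/forall_inP => x; rewrite inE => /eqP ->.
apply/forall_inP => y; rewrite inE => /eqP ->.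
have /eqP -> : dist v v == 0 by rewrite dist_eq0.
by rewrite mulr_ge0.
Qed.

Lemma rips_simplexS r (s t : {set X}) :
  s \in rips_simplex r -> t \subset s -> t != finset.set0 ->
  t \in rips_simplex r.
Proof.
rewrite !inE => /andP[_ /forall_inP sr] /fintype.subsetP ts ->.
apply/forall_inP => x xt; apply/forall_inP => y yt.
by have /forall_inP := sr x (ts x xt); apply; exact: ts.
Qed.

Definition rips (r : {nonneg R}) : scomplex :=
  SComplex (rips_simplex0 r) (@rips_simplex1 r) (@rips_simplexS r).

Lemma rips_mono (r r' : {nonneg R}) : r%:num <= r'%:num ->
  simplex (rips r) \subset simplex (rips r').
Proof.
move=> rr'; apply/fintype.subsetP => s; rewrite !inE.
move=> /andP[-> /forall_inP sr]; apply/forall_inP => x xs; apply/forall_inP => y ys.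
have /forall_inP/(_ y ys) := sr x xs; move=> /le_trans; apply.
by rewrite ler_wpM2l.
Qed.

End Rips.

Section SubdivisionFiltration.
Variables (W : scomplex) (k : nat).

Definition simplex_dim (s : {set vertex W}) : nat := #|s|.-1.

(* A vertex sigma of the barycentric subdivision is a one-element flag, so it
   lies in S(W)_k iff dim sigma >= k - 1. *)
Definition sd_vertex : finType :=
  {s : {set vertex W} | (s \in simplex W) && (k.-1 <= simplex_dim s)%N}.

(* A flag is represented by its set of members.  Dimension increases along a
   flag, so its minimum has dimension >= k - 1 iff all of its members do. *)
Definition sd_simplex : {set {set sd_vertex}} :=
  [set F : {set sd_vertex} | (F != finset.set0) &&
           [forall s in F, forall t in F,
              (val s \subset val t) || (val t \subset val s)]]%SET.

Lemma sd_simplex0 : finset.set0 \notin sd_simplex.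
Proof. by rewrite inE eqxx. Qed.

Lemma sd_simplex1 (v : sd_vertex) : [set v]%SET \in sd_simplex.
Proof.
rewrite inE; apply/andP; split; first by apply/set0Pn; exists v; rewrite inE.
apply/forall_inP => x; rewrite inE => /eqP ->.
by apply/forall_inP => y; rewrite inE => /eqP ->; rewrite subxx.
Qed.

Lemma sd_simplexS (F G : {set sd_vertex}) :
  F \in sd_simplex -> G \subset F -> G != finset.set0 -> G \in sd_simplex.
Proof.
rewrite !inE => /andP[_ /forall_inP FP] /fintype.subsetP GF ->.
apply/forall_inP => x xG; apply/forall_inP => y yG.
by have /forall_inP := FP x (GF x xG); apply; exact: GF.
Qed.

Definition subdivision : scomplex :=
  SComplex sd_simplex0 sd_simplex1 sd_simplexS.

End SubdivisionFiltration.

(* The index set N = {1, 2, ...}. *)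
Definition pos_nat : Type := {k : nat | (0 < k)%N}.
HB.instance Definition _ := SubType.on pos_nat.
HB.instance Definition _ := Choice.on pos_nat.
HB.instance Definition _ :=
  [SubChoice_isSubOrder of pos_nat by <: with Order.NatOrder.nat_display].

(* N^op x [0, oo) with the product order. *)
Notation sr_index R := (pos_nat^d *p {nonneg R}%R)%type.

Section SubdivisionRips.
Variables (R : realType) (X : finite_metric_space R).
Implicit Types p q : sr_index R.

Definition sr_obj p : scomplex := subdivision (rips X p.2) (val p.1).

Lemma sr_map_proof p q (h : (p <= q)%O) (s : vertex (sr_obj p)) :
  (val s \in simplex (rips X q.2)) &&
  ((val q.1).-1 <= @simplex_dim (rips X q.2) (val s))%N.
Proof.
move: h; rewrite leEprod => /andP[k21 r12].
have /andP[sX sk] := valP s; apply/andP; split.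
  exact: (fintype.subsetP (rips_mono X r12)).
by apply: leq_trans sk; rewrite -!subn1 leq_sub2r.
Qed.

Definition sr_map_fun p q (h : (p <= q)%O) (s : vertex (sr_obj p)) :
    vertex (sr_obj q) :=
  Sub (val s) (sr_map_proof h s).

Lemma sr_mapP p q (h : (p <= q)%O) F :
  F \in simplex (sr_obj p) -> (sr_map_fun h @: F)%SET \in simplex (sr_obj q).
Proof.
rewrite !inE => /andP[/set0Pn[x xF] /forall_inP FP]; apply/andP; split.
  by apply/set0Pn; exists (sr_map_fun h x); apply: imset_f.
apply/forall_inP => _ /imsetP[y yF ->]; apply/forall_inP => _ /imsetP[z zF ->].
by have /forall_inP := FP y yF; exact.
Qed.

Definition sr_map p q (h : (p <= q)%O) : smap (sr_obj p) (sr_obj q) :=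
  SMap (@sr_mapP p q h).

Lemma sr_id p (h : (p <= p)%O) v : sr_map h v = v.
Proof. exact: val_inj. Qed.

Lemma sr_comp p q r (hpq : (p <= q)%O) (hqr : (q <= r)%O) (hpr : (p <= r)%O) v :
  sr_map hpr v = sr_map hqr (sr_map hpq v).
Proof. exact: val_inj. Qed.

Definition subdivision_rips : sfunctor (sr_index R) := SFunctor sr_id sr_comp.

End SubdivisionRips.

Record pmod (K : fieldType) (d : Order.disp_t) (P : porderType d) := PMod {
  pm_obj :> P -> lmodType K ;
  pm_map : forall p q : P, (p <= q)%O -> pm_obj p -> pm_obj q ;
  pm_linear : forall (p q : P) (h : (p <= q)%O), linear (pm_map h) ;
  pm_id : forall (p : P) (h : (p <= p)%O) v, pm_map h v = v ;
  pm_comp : forall (p q r : P) (hpq : (p <= q)%O) (hqr : (q <= r)%O)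
      (hpr : (p <= r)%O) v,
    pm_map hpr v = pm_map hqr (pm_map hpq v) }.

Record pmor (K : fieldType) (d : Order.disp_t) (P : porderType d)
    (M N : pmod K P) := PMor {
  pmor_fun : forall p : P, M p -> N p ;
  pmor_linear : forall p : P, linear (@pmor_fun p) ;
  pmor_nat : forall (p q : P) (h : (p <= q)%O) v,
    pmor_fun (pm_map h v) = pm_map h (pmor_fun v) }.

Arguments pmor_fun {K d P M N} _ p.

Section DirectProduct.
Variables (K : fieldType) (I : Type) (V : I -> lmodType K).

Definition dprod : Type := forall i, V i.

HB.instance Definition _ := gen_eqMixin dprod.
HB.instance Definition _ := gen_choiceMixin dprod.

Implicit Types f g h : dprod.

Definition dprod_add f g : dprod := fun i => f i + g i.
Definition dprod_zero : dprod := fun i => 0.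
Definition dprod_opp f : dprod := fun i => - f i.
Definition dprod_scale (a : K) f : dprod := fun i => a *: f i.

Lemma dprod_addA : associative dprod_add.
Proof.
by move=> f g h; apply: functional_extensionality_dep => i; exact: addrA.
Qed.
Lemma dprod_addC : commutative dprod_add.
Proof.
by move=> f g; apply: functional_extensionality_dep => i; exact: addrC.
Qed.
Lemma dprod_add0 : left_id dprod_zero dprod_add.
Proof.
by move=> f; apply: functional_extensionality_dep => i; exact: add0r.
Qed.
Lemma dprod_addN : left_inverse dprod_zero dprod_opp dprod_add.
Proof.
by move=> f; apply: functional_extensionality_dep => i; exact: addNr.
Qed.

HB.instance Definition _ :=
  GRing.isZmodule.Build dprod dprod_addA dprod_addC dprod_add0 dprod_addN.

Lemma dprod_scaleA a b f :
  dprod_scale a (dprod_scale b f) = dprod_scale (a * b) f.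
Proof.
by apply: functional_extensionality_dep => i; exact: scalerA.
Qed.
Lemma dprod_scale1 : left_id 1 dprod_scale.
Proof.
by move=> f; apply: functional_extensionality_dep => i; exact: scale1r.
Qed.
Lemma dprod_scaleDr : right_distributive dprod_scale +%R.
Proof.
by move=> a f g; apply: functional_extensionality_dep => i; exact: scalerDr.
Qed.
Lemma dprod_scaleDl f : {morph dprod_scale^~ f : a b / a + b}.
Proof.
by move=> a b; apply: functional_extensionality_dep => i; exact: scalerDl.
Qed.

HB.instance Definition _ := GRing.Zmodule_isLmodule.Build K dprod
  dprod_scaleA dprod_scale1 dprod_scaleDr dprod_scaleDl.

Definition finsupp_pred : {pred dprod} :=
  fun f => `[< finite_set [set i | f i != 0]%classic >].

Lemma finsupp_submod : submod_closed finsupp_pred.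
Proof.
split=> [|a f g /asboolP ff /asboolP fg]; apply/asboolP.
  by apply: (sub_finite_set _ (@finite_set0 I)) => i /=; rewrite eqxx.
apply: (sub_finite_set _ (_ : finite_set
    ([set i | f i != 0] `|` [set i | g i != 0])%classic)).
  move=> i /=; have -> : (a *: f + g) i = a *: f i + g i by [].
  have [->|] := eqVneq (f i) 0; last by left.
  by rewrite scaler0 add0r; right.
by rewrite finite_setU.
Qed.

HB.instance Definition _ :=
  GRing.isSubmodClosed.Build K dprod finsupp_pred finsupp_submod.

Record dsum := DSum { dsum_val :> dprod ; _ : dsum_val \in finsupp_pred }.

HB.instance Definition _ := [isSub for dsum_val].
HB.instance Definition _ := [Choice of dsum by <:].
HB.instance Definition _ := [SubChoice_isSubLmodule of dsum by <:].

End DirectProduct.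

Section PModules.
Variables (K : fieldType) (d : Order.disp_t) (P : porderType d).
Local Notation pmodule := (pmod K P).

Definition piso (M N : pmodule) : Prop :=
  exists (f : pmor M N) (g : pmor N M),
    forall p, cancel (pmor_fun f p) (pmor_fun g p) /\
              cancel (pmor_fun g p) (pmor_fun f p).

Section DirectSum.
Variables (I : Type) (M : I -> pmodule).

Lemma pdsum_map_proof (p q : P) (h : (p <= q)%O) (f : dsum (fun i => M i p)) :
  (fun i => pm_map h (dsum_val f i)) \in @finsupp_pred K I (fun i => M i q).
Proof.
have /asboolP ff := valP f; apply/asboolP; apply: sub_finite_set ff => i /=.
apply: contraNN => /eqP fi0; apply/eqP; rewrite fi0.
have := pm_linear h (-1) 0 (0 : M i p).
by rewrite scaler0 addr0 scaleN1r addNr.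
Qed.

Definition pdsum_map (p q : P) (h : (p <= q)%O) (f : dsum (fun i => M i p)) :
    dsum (fun i => M i q) := DSum (pdsum_map_proof h f).

Lemma pdsum_linear (p q : P) (h : (p <= q)%O) : linear (pdsum_map h).
Proof.
move=> a f g; apply: val_inj; apply: functional_extensionality_dep => i.
exact: pm_linear.
Qed.

Lemma pdsum_id (p : P) (h : (p <= p)%O) f : pdsum_map h f = f.
Proof.
apply: val_inj; apply: functional_extensionality_dep => i; exact: pm_id.
Qed.

Lemma pdsum_comp (p q r : P) (hpq : (p <= q)%O) (hqr : (q <= r)%O)
    (hpr : (p <= r)%O) f :
  pdsum_map hpr f = pdsum_map hqr (pdsum_map hpq f).
Proof.
apply: val_inj; apply: functional_extensionality_dep => i; exact: pm_comp.
Qed.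

Definition pdsum : pmodule := PMod pdsum_linear pdsum_id pdsum_comp.

End DirectSum.

Section BinarySum.
Variables M N : pmodule.

Definition psum_map (p q : P) (h : (p <= q)%O) (v : (M p * N p)%type) :
    (M q * N q)%type :=
  (pm_map h v.1, pm_map h v.2).

Lemma psum_linear (p q : P) (h : (p <= q)%O) : linear (psum_map h).
Proof. by move=> a u v; rewrite /psum_map !pm_linear. Qed.

Lemma psum_id (p : P) (h : (p <= p)%O) v : psum_map h v = v.
Proof. by case: v => u v; rewrite /psum_map !pm_id. Qed.

Lemma psum_comp (p q r : P) (hpq : (p <= q)%O) (hqr : (q <= r)%O)
    (hpr : (p <= r)%O) v :
  psum_map hpr v = psum_map hqr (psum_map hpq v).
Proof. by rewrite /psum_map !(pm_comp hpq hqr hpr). Qed.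

Definition psum : pmodule :=
  @PMod K d P (fun p => (M p * N p)%type)
    psum_map psum_linear psum_id psum_comp.

End BinarySum.

Section Interval.
Variable p : P.

(* The value at [x] is K ^ 1 = K if [p <= x] and K ^ 0 = 0 otherwise; the
   partial identity matrix induces the identity K -> K or a map from 0. *)
Definition interval_obj (x : P) : lmodType K := 'rV[K]_(p <= x)%O.

Definition interval_map (x y : P) (h : (x <= y)%O) (v : interval_obj x) :
    interval_obj y := v *m pid_mx 1.

Lemma interval_linear (x y : P) (h : (x <= y)%O) : linear (interval_map h).
Proof. by move=> a u v; rewrite /interval_map mulmxDl scalemxAl. Qed.

Lemma interval_id (x : P) (h : (x <= x)%O) v : interval_map h v = v.
Proof.
rewrite /interval_map; move: v; rewrite /interval_obj.
case: (p <= x)%O => /= v; last by rewrite !thinmx0.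
by rewrite pid_mx_1 mulmx1.
Qed.

Lemma interval_comp (x y z : P) (hxy : (x <= y)%O) (hyz : (y <= z)%O)
    (hxz : (x <= z)%O) v :
  interval_map hxz v = interval_map hyz (interval_map hxy v).
Proof.
have : (p <= x)%O -> (p <= y)%O by move=> /le_trans; apply.
rewrite /interval_map; move: v; rewrite /interval_obj.
case: (p <= x)%O => /= v; last by move=> _; rewrite (thinmx0 v) !mul0mx.
by move=> -> //=; rewrite pid_mx_1 mulmx1.
Qed.

Definition interval : pmodule :=
  PMod interval_linear interval_id interval_comp.

End Interval.

Definition is_free (M : pmodule) : Prop :=
  exists (I : Type) (g : I -> P), piso M (pdsum (fun i => interval (g i))).

Definition fg_free (M : pmodule) : Prop :=
  exists (n : nat) (g : 'I_n -> P), piso M (pdsum (fun i => interval (g i))).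

(* [e] exhibits [M] as the cokernel of [f]. *)
Definition is_cokernel (A B M : pmodule) (f : pmor A B) (e : pmor B M) : Prop :=
  forall p,
    (forall m, exists b, pmor_fun e p b = m) /\
    (forall b, pmor_fun e p b = 0 <-> exists a, pmor_fun f p a = b).

Definition finitely_presented (M : pmodule) : Prop :=
  exists (F1 F0 : pmodule) (f : pmor F1 F0) (e : pmor F0 M),
    [/\ fg_free F1, fg_free F0 & is_cokernel f e].

Record pcomplex := PComplex {
  pc_obj :> nat -> pmodule ;
  pc_d : forall n, pmor (pc_obj n.+1) (pc_obj n) ;
  pc_dd : forall n p v, pmor_fun (pc_d n) p (pmor_fun (pc_d n.+1) p v) = 0 }.

Definition pc_iso (C D : pcomplex) : Prop :=
  exists (f : forall n, pmor (C n) (D n)) (g : forall n, pmor (D n) (C n)),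
    (forall n p, cancel (pmor_fun (f n) p) (pmor_fun (g n) p) /\
                 cancel (pmor_fun (g n) p) (pmor_fun (f n) p)) /\
    (forall n p v, pmor_fun (f n) p (pmor_fun (pc_d C n) p v) =
                   pmor_fun (pc_d D n) p (pmor_fun (f n.+1) p v)).

Section ComplexSum.
Variables C D : pcomplex.

Definition pc_sum_fun n (p : P) (v : psum (C n.+1) (D n.+1) p) :
    psum (C n) (D n) p :=
  (pmor_fun (pc_d C n) p v.1, pmor_fun (pc_d D n) p v.2).

Lemma pc_sum_linear n (p : P) : linear (@pc_sum_fun n p).
Proof. by move=> a u v; rewrite /pc_sum_fun !pmor_linear. Qed.

Lemma pc_sum_nat n (p q : P) (h : (p <= q)%O) v :
  pc_sum_fun (pm_map h v) = pm_map h (@pc_sum_fun n p v).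
Proof. by rewrite /pc_sum_fun /= !pmor_nat. Qed.

Definition pc_sum_d n : pmor (psum (C n.+1) (D n.+1)) (psum (C n) (D n)) :=
  PMor (@pc_sum_linear n) (@pc_sum_nat n).

Lemma pc_sum_dd n p v :
  pmor_fun (pc_sum_d n) p (pmor_fun (pc_sum_d n.+1) p v) = 0.
Proof. by rewrite /= /pc_sum_fun /= !pc_dd. Qed.

Definition pc_sum : pcomplex :=
  @PComplex (fun n => psum (C n) (D n)) pc_sum_d pc_sum_dd.

End ComplexSum.

Definition free_resolution (M : pmodule) (F : pcomplex) : Prop :=
  [/\ forall n, is_free (F n),
      forall n p v, pmor_fun (pc_d F n) p v = 0 ->
        exists u, pmor_fun (pc_d F n.+1) p u = v
    & exists e : pmor (F 0) M, is_cokernel (pc_d F 0) e].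

Definition minimal_resolution (M : pmodule) (F : pcomplex) : Prop :=
  free_resolution M F /\
  forall F', free_resolution M F' -> exists D, pc_iso F' (pc_sum F D).

Definition generates (M : pmodule) (S : set {p : P & M p}) : Prop :=
  forall (x : P) (v : M x),
    exists (n : nat) (g : 'I_n -> {p : P & M p}) (c : 'I_n -> K)
           (le_gx : forall i, (tag (g i) <= x)%O),
      (forall i, S (g i)) /\
      v = \sum_(i < n) c i *: pm_map (le_gx i) (tagged (g i)).

Definition minimal_generating_set (M : pmodule) (S : set {p : P & M p}) :
    Prop :=
  generates S /\ forall S', (S' `<=` S)%classic -> generates S' -> S' = S.

Definition is_betti (i : nat) (M : pmodule) (b : nat) : Prop :=
  exists F : pcomplex, minimal_resolution M F /\
  exists S : set {p : P & F i p},
    minimal_generating_set S /\ (S #= `I_b)%card.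

(* The value of [betti] is +oo when no [b] satisfies [is_betti]; this does not
   happen for finitely presented modules over a finite product of totally
   ordered sets. *)
Definition betti (R : realType) (i : nat) (M : pmodule) : \bar R :=
  xget +oo%E [set b%:R%:E | b in is_betti i M]%classic.

End PModules.

Section Chains.
Variables (K : fieldType) (j : nat).
Local Notation tup A := {ffun 'I_j.+1 -> vertex A}.

(* Oriented j-chains, presented as alternating functions on ordered simplices:
   the oriented simplex [v_0, ..., v_j] corresponds to the function with value
   the sign of s at (v_(s 0), ..., v_(s j)) and 0 elsewhere.  This makes sense
   in every characteristic. *)
Definition chain_pred (A : scomplex) :
    {pred {ffun tup A -> K^o}} :=
  fun c =>
    [forall v : tup A, (c v != 0) ==>
       injectiveb v && ((v @: [set: 'I_j.+1])%SET \in simplex A)] &&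
    [forall v : tup A, forall s : {perm 'I_j.+1},
       c [ffun i => v (s i)] == (-1) ^+ s * c v].

Lemma chain_submod (A : scomplex) : submod_closed (@chain_pred A).
Proof.
split=> [|a f g /andP[/forallP f1 /forallP f2] /andP[/forallP g1 /forallP g2]].
  apply/andP; split; apply/forallP => v; first by rewrite ffunE eqxx.
  by apply/forallP => s; rewrite !ffunE mulr0.
apply/andP; split; apply/forallP => v.
  rewrite !ffunE; apply/implyP => fg.
  have [f0|f0] := eqVneq (f v) 0; last exact: implyP (f1 v) f0.
  apply: (implyP (g1 v)); apply: contraNN fg => /eqP ->.
  by rewrite f0 scaler0 addr0.
apply/forallP => s; have /forallP/(_ s)/eqP fs := f2 v.
have /forallP/(_ s)/eqP gs := g2 v.
by rewrite !ffunE fs gs mulrDr scalerAr.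
Qed.

HB.instance Definition _ (A : scomplex) :=
  GRing.isSubmodClosed.Build K _ (@chain_pred A) (@chain_submod A).

Record chain (A : scomplex) := Chain {
  chain_val :> {ffun tup A -> K^o} ;
  _ : chain_val \in @chain_pred A }.

HB.instance Definition _ (A : scomplex) := [isSub for @chain_val A].
HB.instance Definition _ (A : scomplex) := [Choice of chain A by <:].
HB.instance Definition _ (A : scomplex) :=
  [SubChoice_isSubLmodule of chain A by <:].

(* f [v_0, ..., v_j] = [f v_0, ..., f v_j], which is 0 if two entries agree. *)
Definition chain_push (A B : scomplex) (f : smap A B) (c : chain A) :
    {ffun tup B -> K^o} :=
  [ffun w : tup B =>
     if injectiveb w then
       \sum_(v : tup A | [ffun i => f (v i)] == w) c v
     else 0].

Lemma chain_pushP (A B : scomplex) (f : smap A B) (c : chain A) :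
  chain_push f c \in @chain_pred B.
Proof.
have /andP[/forallP c1 /forallP c2] := valP c.
apply/andP; split; apply/forallP => w; rewrite !ffunE.
  case: ifP => [wi|]; last by rewrite eqxx.
  apply/implyP => sn0; rewrite andTb.
  have [v /eqP vw cv] : exists2 v : tup A,
      [ffun i => f (v i)] == w & c v != 0.
    apply/exists_inP; apply: contraNT sn0 => /exists_inPn cv.
    by rewrite big1// => v vw; apply/eqP; rewrite -[_ == _]negbK; exact: cv.
  have /andP[_ vA] := implyP (c1 v) cv.
  suff -> : (w @: [set: 'I_j.+1])%SET = (f @: (v @: [set: 'I_j.+1]))%SET.
    exact: smapP.
  rewrite -imset_comp; apply: eq_imset => i.
  by rewrite -vw ffunE.
apply/forallP => s; rewrite !ffunE.
have -> : injectiveb [ffun i => w (s i)] = injectiveb w.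
  apply/injectiveP/injectiveP => wi.
    move=> x y wxy; apply: (perm_inj (s := s^-1)); apply: wi.
    by rewrite !ffunE !permKV.
  by move=> x y; rewrite !ffunE => /wi /perm_inj.
case: ifP => _; last by rewrite mulr0.
rewrite big_distrr /=.
have bij : {on [pred v : tup A |
     [ffun i => f (v i)] == [ffun i => w (s i)]], bijective
     (fun v : tup A => [ffun i => v (s i)])}.
  apply: onW_bij.
  exists (fun v : tup A => [ffun i => v (s^-1%g i)] : tup A) => v;
    by apply/ffunP => i; rewrite !ffunE ?permK ?permKV.
rewrite (reindex _ bij) /=; apply/eqP; apply: eq_big => [v|v _].
  apply/eqP/eqP => /ffunP vw; apply/ffunP => i.
    by have := vw (s^-1%g i); rewrite !ffunE permKV.
  by have := vw (s i); rewrite !ffunE.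
by have /forallP/(_ s)/eqP := c2 v.
Qed.

Definition chain_map (A B : scomplex) (f : smap A B) (c : chain A) : chain B :=
  Chain (chain_pushP f c).

Lemma chain_map_linear (A B : scomplex) (f : smap A B) : linear (chain_map f).
Proof.
move=> a c e; apply: val_inj; apply/ffunP => w; rewrite !ffunE.
case: ifP => _; last by rewrite scaler0 addr0.
by rewrite scaler_sumr -big_split; apply: eq_bigr => v _; rewrite !ffunE.
Qed.

Variables (d : Order.disp_t) (P : porderType d) (G : sfunctor P).

Lemma chain_map_id (p : P) (h : (p <= p)%O) c : chain_map (sf_map G h) c = c.
Proof.
apply: val_inj; apply/ffunP => w; rewrite !ffunE.
have /andP[/forallP c1 _] := valP c.
have := implyP (c1 w); case: ifP => [_ _|_ cw].
  rewrite (big_pred1 w) // => v; apply/eqP/eqP => [<-|->];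
  by apply/ffunP => i; rewrite ffunE sf_id.
by apply/esym/eqP; apply: contraFT (erefl false) => /cw.
Qed.

Lemma chain_map_comp (p q r : P) (hpq : (p <= q)%O) (hqr : (q <= r)%O)
    (hpr : (p <= r)%O) c :
  chain_map (sf_map G hpr) c =
  chain_map (sf_map G hqr) (chain_map (sf_map G hpq) c).
Proof.
apply: val_inj; apply/ffunP => w; rewrite !ffunE.
case: ifP => // /injectiveP wi.
rewrite (partition_big
  (fun v : tup (G p) => [ffun i => sf_map G hpq (v i)])
  (fun u : tup (G q) =>
     [ffun i => sf_map G hqr (u i)] == w)) /=.
  apply: eq_bigr => u /eqP uw; rewrite ffunE.
  have -> : injectiveb u.
    by apply/injectiveP => x y uxy; apply: wi; rewrite -uw !ffunE uxy.
  apply: eq_bigl => v; rewrite andbC; case: eqP => // vu /=.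
  rewrite -uw -vu; apply/eqP/ffunP => i.
  by rewrite !ffunE (sf_comp hpq hqr hpr).
move=> v /eqP <-; apply/eqP/ffunP => i.
by rewrite !ffunE (sf_comp hpq hqr hpr).
Qed.

Definition chain_module : pmod K P :=
  @PMod K d P (fun p => chain (G p)) (fun p q h => chain_map (sf_map G h))
    (fun p q h => chain_map_linear (sf_map G h)) chain_map_id chain_map_comp.

End Chains.

Definition sf_finitely_presented (K : fieldType) (d : Order.disp_t)
    (P : porderType d) (G : sfunctor P) : Prop :=
  forall j, finitely_presented (chain_module K j G).

Definition size_of (R : realType) (K : fieldType) (d : Order.disp_t)
    (P : porderType d) (G : sfunctor P) : \bar R :=
  (betti R 1 (chain_module K 0 G) +
   \sum_(0 <= j <oo) betti R 0 (chain_module K j G))%E.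

Section Plane.
Variable R : realType.

Definition l2_dist (x y : R * R) : R :=
  Num.sqrt ((x.1 - y.1) ^+ 2 + (x.2 - y.2) ^+ 2).

Lemma l2_dist_eq0 x y : (l2_dist x y == 0) = (x == y).
Proof.
rewrite sqrtr_eq0 le_eqVlt [_ < 0]ltNge addr_ge0 ?sqr_ge0// orbF.
rewrite paddr_eq0 ?sqr_ge0// !sqrf_eq0 !subr_eq0.
by case: x y => [x1 x2] [y1 y2].
Qed.

Lemma l2_dist_sym x y : l2_dist x y = l2_dist y x.
Proof. by rewrite /l2_dist -(opprB x.1) -(opprB x.2) !sqrrN. Qed.

Lemma l2_dist_triangle x y z : l2_dist x z <= l2_dist x y + l2_dist y z.
Proof.
rewrite /l2_dist; set a := x.1 - y.1; set b := x.2 - y.2.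
set c := y.1 - z.1; set e := y.2 - z.2.
have -> : x.1 - z.1 = a + c by rewrite /a /c addrA subrK.
have -> : x.2 - z.2 = b + e by rewrite /b /e addrA subrK.
have s0 : 0 <= a ^+ 2 + b ^+ 2 by rewrite addr_ge0 ?sqr_ge0.
have t0 : 0 <= c ^+ 2 + e ^+ 2 by rewrite addr_ge0 ?sqr_ge0.
have r0 : 0 <= Num.sqrt (a ^+ 2 + b ^+ 2) + Num.sqrt (c ^+ 2 + e ^+ 2).
  by rewrite addr_ge0 ?sqrtr_ge0.
rewrite -[leRHS](ger0_norm r0) -sqrtr_sqr ler_wsqrtr//.
rewrite [leRHS]sqrrD !sqr_sqrtr//.
have : a * c + b * e <= Num.sqrt (a ^+ 2 + b ^+ 2) * Num.sqrt (c ^+ 2 + e ^+ 2).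
  rewrite -sqrtrM//; apply: le_trans (ler_norm _) _.
  rewrite -sqrtr_sqr ler_wsqrtr//.
  rewrite -subr_ge0; have -> : (a ^+ 2 + b ^+ 2) * (c ^+ 2 + e ^+ 2)
    - (a * c + b * e) ^+ 2 = (a * e - b * c) ^+ 2 by ring.
  exact: sqr_ge0.
set m := Num.sqrt _ * Num.sqrt _ => h; nra.
Qed.

Section Subspace.
Variable X : {fset (R * R)%type}.

Lemma planar_eq0 (x y : X) : (l2_dist (val x) (val y) == 0) = (x == y).
Proof. exact: l2_dist_eq0. Qed.

Definition planar : finite_metric_space R :=
  @FiniteMetricSpace R X (fun x y => l2_dist (val x) (val y)) planar_eq0
    (fun x y => l2_dist_sym _ _) (fun x y z => l2_dist_triangle _ _ _).

End Subspace.

Definition circle_points (t : R) (n : nat) : {fset (R * R)%type} :=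
  let angle (i : 'I_n) := t + 2 * pi * i%:R / n%:R in
  [fset (cos (angle i), sin (angle i)) | i in 'I_n]%fset.

End Plane.

Section Probability.
Variables (R : realType) (d : measure_display) (T : measurableType d).
Variable Pr : probability T R.
Local Open Scope classical_set_scope.
Local Open Scope ereal_scope.

Definition mutually_independent (d' : measure_display) (U : measurableType d')
    (I : finType) (x : I -> T -> U) : Prop :=
  forall (J : {set I}) (A : I -> set U), (forall i, measurable (A i)) ->
    Pr (\bigcap_(i in [set` J]) (x i @^-1` A i)) =
    \prod_(i in J) Pr (x i @^-1` A i).

Definition uniform_on_unit_square
    (x : T -> measurableTypeR R * measurableTypeR R) : Prop :=
  forall A, measurable A ->
    Pr (x @^-1` A) =
    (lebesgue_measure \x lebesgue_measure)
      (A `&` (`[0%R, 1%R] `*` `[0%R, 1%R])).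

Definition iid_unit_square_sample (n : nat)
    (x : 'I_n -> T -> measurableTypeR R * measurableTypeR R) : Prop :=
  [/\ forall i, measurable_fun setT (x i),
      mutually_independent x
    & forall i, uniform_on_unit_square (x i)].

Definition sample_set (n : nat)
    (x : 'I_n -> T -> measurableTypeR R * measurableTypeR R) (w : T) :
    {fset (R * R)%type} :=
  [fset (x i w : (R * R)%type) | i in 'I_n]%fset.

(* Equals [Pr A] if [A] is measurable. *)
Definition inner_probability (A : set T) : \bar R :=
  ereal_sup [set Pr E | E in [set E | measurable E /\ E `<=` A]].

End Probability.

(* Main.v *)
Require Import Defs.
From mathcomp Require Import all_boot all_order all_algebra finmap.
From mathcomp Require Import interval_inference.
From mathcomp Require Import all_classical all_reals all_analysis.
From mathcomp Require Import perm measurable_realfun lra ring zify.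

Set Implicit Arguments.
Unset Strict Implicit.
Unset Printing Implicit Defensive.

Import Order.TTheory GRing.Theory Num.Theory.
Import numFieldNormedType.Exports.

Local Open Scope classical_set_scope.
Local Open Scope ring_scope.

(** The size of a model is bounded below by a count of connected pieces at a
single index. For a functor G to complexes, a minimal generating set of the
first term of a resolution of C_0 G spans C_0 G_p at every index p, so the size
of G is at least the number of vertices of G_p (card_vertex_le_size). Every
nonempty clopen subset of the realization of G_p contains a vertex, so this
number is at least the number of members of any family of disjoint nonempty
clopen subsets (clopen_pieces_card). Having such a family of pieces is an
invariant of homotopy equivalence, as homotopies move points along paths and
paths do not leave clopen sets; hence it passes from the subdivision-Rips
complex at p to G_p (weakly_equivalent_clopen_pieces).

At the index (k, r), a maximal simplex of the Rips complex with exactly k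
vertices is comparable to no other simplex with at least k vertices. It is
therefore an isolated vertex of the subdivision-Rips complex, and contributes a
clopen piece of its own. Choosing the best k, the size of a model is at least
the number of maximal simplices at scale r divided by the number of points
(maximal_simplices_le_size).

If the data contain points a_i and b_i, for i in an index set of m elements,
such that d(a_i, b_i) > 2r while all other distances among these points are at
most 2r, then the choices of one point from each pair are simplices, no two of
which lie in a common simplex. So there are at least 2 ^ m maximal simplices,
whatever the remaining points are, and the size is at least 2 ^ m divided by
the number of points (crossing_pairs_le_size).

On the circle with n uniformly spaced points, points half a turn apart are the
farthest ones. For odd n each point has two farthest points; using only the
points of even index on one half of the circle, and the points n / 2 steps
after these, separates the pairs and gives m = n / 4 (circle_model_size).

In the square, consider two opposite arcs of the inscribed circle, cut into M
pieces of length e of order 1 / M, with gaps between consecutive pieces. Two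
opposite points are at distance 1; moving one of them by t along the circle
lowers the squared distance by about t ^ 2. So if every piece is thickened to a
box of height of order e ^ 2, points in opposite boxes are farther apart than
points in boxes that are not opposite (box_dist). A box has area of order e ^
3, so about n / M ^ 3 of n random points fall in it, and M can be taken of
order n ^ (1/3). With high probability at least half of the pairs of opposite
boxes have both boxes occupied: otherwise M / 2 boxes miss the sample, which
for a given set of boxes has probability at most exp (-4 M), and there are at
most 4 ^ M sets of boxes (dense_event_probability). *)

(** * Clopen pieces of a space *)

(** A way to say that a space has at least as many pieces as I has elements,
    phrased with clopen sets so that it can be pulled back along continuous
    maps. *)
Definition clopen_pieces (I : Type) (X : topologicalType) : Prop :=
  exists U : I -> set X,
    [/\ forall i, clopen (U i), forall i, U i !=set0
      & forall i j x, U i x -> U j x -> i = j].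

(** The image of the unit interval under a path is connected. *)
Lemma clopen_path (R : realType) (X : topologicalType) (U : set X)
    (g : R -> X) :
  clopen U -> {within `[0, 1], continuous g} -> U (g 0) <-> U (g 1).
Proof.
wlog suff H : U / clopen U -> {within `[0, 1], continuous g} ->
    U (g 0) -> U (g 1).
  move=> Uc gc; split; first exact: H.
  apply: contraPP => U0; apply: (H (~` U)) => //.
  by case: Uc => Uo Uc; split; [exact: closed_openC | exact: open_closedC].
move=> [Uo Uc] gc U0.
have in01 (t : R) : 0 <= t <= 1 -> [set` `[0, 1]] t by rewrite /= in_itv.
have cg := connected_continuous_connected (@segment_connected R 0 1) gc.
have {}cg : g @` `[0, 1] `&` U = g @` `[0, 1].
  apply: cg; [exists (g 0); split => // | by exists U | by exists U].
  by exists 0 => //; apply: in01; rewrite lexx ler01.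
have : (g @` `[0, 1]) (g 1) by exists 1 => //; apply: in01; rewrite ler01 lexx.
by rewrite -cg => -[].
Qed.

Lemma homotopic_clopen (R : realType) (X Y : topologicalType) (f g : X -> Y)
    (U : set Y) (x : X) :
  homotopic R f g -> clopen U -> U (f x) <-> U (g x).
Proof.
move=> [H [cH H0 H1]] Uc; rewrite -H0 -H1.
apply: (@clopen_path R _ _ (fun t => H (x, t))) => //.
move/subspace_continuousP: cH => cH; apply/subspace_continuousP => t t01.
have cp : (fun t : R => (x, t)) @ within [set` `[0, 1]] (nbhs t)
    --> within ([set: X] `*` [set` `[0, 1]]) (nbhs (x, t)).
  move=> W [[P1 P2] /= [P1x P2t] PW]; rewrite nbhs_simpl.
  apply: filterS P2t => s P2s s01; apply: (PW (x, s)) => //.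
  by split => //; exact: nbhs_singleton P1x.
exact: cvg_comp cp (cH (x, t) (conj I t01)).
Qed.

(** Preimages of the pieces under one of the two inverse maps are clopen and
    disjoint.  They are nonempty because the composite of the two maps is
    homotopic to the identity, and thus keeps each point in its piece. *)
Lemma homotopy_equivalence_clopen_pieces (R : realType) (I : Type)
    (X Y : topologicalType) (f : X -> Y) :
  homotopy_equivalence R f -> clopen_pieces I X <-> clopen_pieces I Y.
Proof.
move=> [cf [g [cg gf fg]]].
have transfer (A B : topologicalType) (u : A -> B) (v : B -> A) :
    continuous u -> homotopic R (u \o v) id ->
    clopen_pieces I B -> clopen_pieces I A.
  move=> cu uv [U [Uc Un Ui]]; exists (fun i => u @^-1` U i).
  split => [i|i|i j x].
  - have [Uo Ucl] := Uc i; split.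
      by move/continuousP: cu; apply.
    by move/continuous_closedP: cu; apply.
  - have [y Uy] := Un i; exists (v y).
    exact/(homotopic_clopen y uv (Uc i)).
  - exact: Ui.
by split; [exact: transfer cg gf | exact: transfer cf fg].
Qed.

Lemma weakly_equivalent_clopen_pieces (R : realType) (d : Order.disp_t)
    (P : porderType d) (F G : tfunctor P) (I : Type) (p : P) :
  weakly_equivalent R F G -> clopen_pieces I (F p) <-> clopen_pieces I (G p).
Proof.
elim=> {F G}[F G [eta he]|F|F G _ IH|F G H _ IH1 _ IH2] //.
- exact: homotopy_equivalence_clopen_pieces (he p).
- by split=> /IH.
- by rewrite IH1.
Qed.

Section RealizationPieces.
Variables (R : realType) (A : scomplex).

Lemma coord_continuous (v : vertex A) :
  continuous (fun x : realization R A => set_val x v).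
Proof.
move=> x.
have cval : continuous (set_val : realization R A -> {ptws vertex A -> R}).
  exact: initial_continuous.
exact: (continuous_comp (cval x)
  (@proj_continuous (vertex A) (fun=> R) v (set_val x))).
Qed.

Definition isolated_vertex (v : vertex A) : Prop :=
  forall s, s \in simplex A -> v \in s -> s = [set v]%SET.

(** The support of a point of the realization is a simplex. *)
Lemma isolated_vertex_coord (v : vertex A) (x : realization R A) :
  isolated_vertex v -> set_val x v != 0 -> set_val x v = 1.
Proof.
move=> iv xv; have [x0 x1 xs] : realization_set (set_val x) := set_valP x.
have sv := iv _ xs; rewrite inE in sv; have {}sv := sv xv.
rewrite -x1 (bigD1 v) //= big1 ?addr0 // => w wv.
apply/eqP; apply: contraNT wv => xw.
by have : w \in [set v]%SET; [rewrite -sv inE | rewrite inE].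
Qed.

Definition vertex_coord (v : vertex A) : {ptws vertex A -> R} :=
  fun w => (w == v)%:R.

Lemma vertex_point_proof (v : vertex A) :
  vertex_coord v \in realization_set (A := A).
Proof.
rewrite in_setE /vertex_coord; split => [w||]; first by rewrite ler0n.
  by rewrite (bigD1 v) //= eqxx big1 ?addr0 // => w /negbTE ->.
suff -> : [set w | (w == v)%:R != 0 :> R]%SET = [set v]%SET by exact: simplex1.
by apply/setP => w; rewrite !inE pnatr_eq0; case: (w == v).
Qed.

Definition vertex_point (v : vertex A) : realization R A :=
  exist _ (vertex_coord v) (vertex_point_proof v).

Lemma vertex_pointE (v w : vertex A) :
  set_val (vertex_point v) w = (w == v)%:R.
Proof. by []. Qed.

(** The barycentric coordinate at an isolated vertex is continuous and takes
    only the values 0 and 1, so the set where it is positive, which is open,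
    is also the set where it is 1, which is closed. *)
Lemma isolated_clopen_pieces (I : Type) (v : I -> vertex A) :
  injective v -> (forall i, isolated_vertex (v i)) ->
  clopen_pieces I (realization R A).
Proof.
move=> vi iv; exists (fun i => [set x | set_val x (v i) = 1]); split.
- move=> i; pose q (x : realization R A) := set_val x (v i).
  have cq : continuous q by exact: coord_continuous.
  split; last first.
    exact: (continuous_closedP _).1 cq [set 1] (@closed_eq R 1).
  have -> : [set x | set_val x (v i) = 1] = q @^-1` [set t : R | 0 < t].
    apply/seteqP; split => x /= qx; first by rewrite /q qx ltr01.
    by apply: isolated_vertex_coord => //; rewrite gt_eqF.
  by apply: ((continuousP _).1 cq); exact: open_gt.
- by move=> i; exists (vertex_point (v i)); rewrite /= vertex_pointE eqxx.
- move=> i j x /= xi xj; apply: vi.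
  have [_ _ xs] : realization_set (set_val x) := set_valP x.
  have supp k : set_val x (v k) = 1 ->
      v k \in [set w | set_val x w != 0]%SET.
    by move=> xk; rewrite inE xk oner_neq0.
  by have := supp j xj; rewrite (iv i _ xs (supp i xi)) inE => /eqP.
Qed.

(** A point is joined to any vertex of its support by a segment inside the
    closed simplex spanned by the support. *)
Lemma clopen_contains_vertex (U : set (realization R A)) :
  clopen U -> U !=set0 -> exists v, U (vertex_point v).
Proof.
move=> Uc [x Ux]; have [x0 x1 xs] : realization_set (set_val x) := set_valP x.
have /set0Pn[v] : [set v | set_val x v != 0]%SET != finset.set0.
  by apply: contraTneq xs => ->; exact: simplex0.
rewrite inE => xv; exists v.
(* Clamping the parameter extends the segment to a path on the whole line. *)
pose clamp (t : R) := Num.max 0 (Num.min t 1).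
have clamp01 t : 0 <= clamp t <= 1.
  by rewrite /clamp le_max lexx /= ge_max ler01 ge_min lexx orbT.
pose h (t : R) : {ptws vertex A -> R} :=
  fun w => (1 - clamp t) * set_val x w + clamp t * (w == v)%:R.
have hP t : h t \in realization_set (A := A).
  have /andP[c0 c1] := clamp01 t.
  rewrite in_setE; split => [w||].
  - by rewrite addr_ge0 // mulr_ge0 // ?subr_ge0 ?x0 ?ler0n.
  - rewrite big_split /= -!mulr_sumr x1 (bigD1 v) //= eqxx.
    by rewrite big1 ?addr0 ?mulr1 ?subrK // => w /negbTE ->.
  - apply: (simplexS xs).
      apply/fintype.subsetP => w; rewrite !inE; apply: contraNneq => xw.
      rewrite /h xw mulr0 add0r.
      case: (eqVneq w v) => [wv|_]; last by rewrite mulr0.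
      by move: xv; rewrite -wv xw eqxx.
    apply/set0Pn; have [c10|c10] := eqVneq (1 - clamp t) 0.
      exists v; rewrite inE /h c10 mul0r add0r eqxx mulr1.
      by apply: contraTneq (ltr01 : 0 < 1 :> R) => ct0; lra.
    exists v; rewrite inE /h eqxx mulr1.
    have xv0 : 0 < set_val x v by rewrite lt_def xv x0.
    have : 0 < 1 - clamp t by rewrite lt_def c10 subr_ge0.
    by move=> c0'; rewrite gt_eqF // ltr_pwDl // mulr_gt0.
pose g t : realization R A := exist _ (h t) (hP t).
have cg : continuous g.
  apply: continuous_comp_initial; apply: ptws_continuous => w.
  have cc : continuous clamp.
    move=> t; apply: (@continuous_max R R (fun=> 0) (fun t => Num.min t 1) t).
      exact: cst_continuous.
    apply: (@continuous_min R R id (fun=> 1) t); last exact: cst_continuous.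
    exact: cvg_id.
  move=> t; apply: cvgD; apply: cvgM; try exact: cvg_cst; last exact: cc.
  by apply: cvgB; [exact: cvg_cst | exact: cc].
have g0 : g 0 = x.
  apply: val_inj; apply/funext => w; rewrite [LHS]/= /h.
  have -> : clamp 0 = 0 by rewrite /clamp min_l ?ler01 // maxxx.
  by rewrite subr0 mul1r mul0r addr0.
have g1 : g 1 = vertex_point v.
  apply: val_inj; apply/funext => w; rewrite [LHS]/= /h.
  have -> : clamp 1 = 1 by rewrite /clamp minxx max_r ?ler01.
  by rewrite subrr mul0r mul1r add0r.
rewrite -g1; apply/(clopen_path Uc); last by rewrite g0.
exact: continuous_subspaceT.
Qed.

(** Disjoint pieces contain distinct vertices. *)
Lemma clopen_pieces_card (I : finType) :
  clopen_pieces I (realization R A) -> (#|I| <= #|vertex A|)%N.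
Proof.
move=> [U [Uc Un Ui]].
have [v vU] := boolp.choice (fun i => clopen_contains_vertex (Uc i) (Un i)).
rewrite -(card_imset I (f := v)); last first.
  by move=> i j vij; apply: (Ui i j (vertex_point (v i))); rewrite // vij.
by apply: max_card.
Qed.

End RealizationPieces.

(** * Vertices and the zeroth Betti number *)

Definition spanned_by (K : fieldType) (V : lmodType K) (b : nat) : Prop :=
  exists w : 'I_b -> V,
    forall v, exists a : 'I_b -> K, v = \sum_(i < b) a i *: w i.

Section VertexChains.
Variables (K : fieldType) (A : scomplex).

Definition vertex_chain_val (v : vertex A) :
    {ffun {ffun 'I_1 -> vertex A} -> K^o} :=
  [ffun f : {ffun 'I_1 -> vertex A} => (f ord0 == v)%:R].

Lemma vertex_chain_proof v : vertex_chain_val v \in @chain_pred K 0 A.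
Proof.
apply/andP; split; apply/forallP => f.
  apply/implyP => _; apply/andP; split.
    by apply/injectiveP => i j _; rewrite !ord1.
  suff -> : (f @: [set: 'I_1] = [set f ord0])%SET by exact: simplex1.
  apply/setP => x; rewrite inE; apply/imsetP/eqP => [[i _ ->]|->].
    by rewrite ord1.
  by exists ord0.
apply/forallP => s.
have -> : s = 1%g by apply/permP => i; rewrite !ord1.
have -> : [ffun i => f ((1%g : {perm 'I_1}) i)] = f.
  by apply/ffunP => i; rewrite ffunE perm1.
by rewrite odd_perm1 expr0 mul1r.
Qed.

Definition vertex_chain v : chain K 0 A := Chain (vertex_chain_proof v).

(** The coordinates of the vertex chains form an identity matrix, which factors
    through the coefficients on a spanning family. *)
Lemma card_vertex_spanned (b : nat) :
  spanned_by (chain K 0 A) b -> (#|vertex A| <= b)%N.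
Proof.
move=> [w spanw].
pose ev (u : vertex A) (c : chain K 0 A) : K := chain_val c [ffun=> u].
have ev_sum u (a : 'I_b -> K) :
    ev u (\sum_i a i *: w i) = \sum_i a i * ev u (w i).
  have ev0 : ev u 0 = 0 by rewrite /ev /= ffunE.
  have evD : {morph ev u : x y / x + y} by move=> x y; rewrite /ev /= ffunE.
  rewrite (big_morph _ evD ev0); apply: eq_bigr => i _.
  by rewrite /ev /= ffunE.
have [a aP] := boolp.choice (fun v => spanw (vertex_chain v)).
apply: (@mulmx1_min K _ _
  (\matrix_(i < #|vertex A|, j < b) a (enum_val i) j)
  (\matrix_(j < b, i < #|vertex A|) ev (enum_val i) (w j))).
apply/matrixP => i k; rewrite !mxE.
under eq_bigr do rewrite !mxE.
rewrite -ev_sum -aP /ev /= !ffunE.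
by rewrite (inj_eq enum_val_inj) eq_sym.
Qed.

End VertexChains.

Section BettiBound.
Variables (K : fieldType) (d : Order.disp_t) (P : porderType d).

(** The first term of a resolution maps onto the module, and at a given index
    it is spanned by the images of those generators that live at or below
    this index. *)
Lemma is_betti0_spanned (M : pmod K P) (b : nat) (p : P) :
  is_betti 0 M b -> spanned_by (M p) b.
Proof.
move=> [F [[[_ _ [e eP]] _] [S [[Sgen _] Sb]]]].
have /card_set_bijP[f [fb fi _]] := Sb.
(* Generators that do not live at or below p get the value 0. *)
have /boolp.choice[w wP] : forall i : 'I_b, exists m : M p, forall s, S s ->
    f s = i -> forall h : (tag s <= p)%O,
    pmor_fun e p (pm_map h (tagged s)) = m.
  move=> i.
  have [[s [Ss fs h]]|noS] :=
      pselect (exists s, [/\ S s, f s = i & (tag s <= p)%O]).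
    exists (pmor_fun e p (pm_map h (tagged s))) => s' Ss' fs' h'.
    have ss' : s' = s by apply: fi; rewrite ?in_setE // fs'.
    by move: h'; rewrite ss' => h'; rewrite (bool_irrelevance h' h).
  by exists 0 => s Ss fs h; case: noS; exists s.
exists w => v; have [/(_ v)[u <-] _] := eP p.
have [n [g [c [le_g [gS ->]]]]] := Sgen p u.
pose phi i : 'I_b := Ordinal (fb _ (gS i)).
exists (fun j => \sum_(i < n | phi i == j) c i).
have -> : pmor_fun e p (\sum_(i < n) c i *: pm_map (le_g i) (tagged (g i))) =
    \sum_(i < n) c i *: w (phi i).
  have lin := pmor_linear e (p := p).
  have e0 : pmor_fun e p 0 = 0.
    by have := lin (-1) 0 0; rewrite scaler0 addr0 scaleN1r addNr.
  have eD : {morph pmor_fun e p : x y / x + y}.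
    by move=> x y; have := lin 1 x y; rewrite !scale1r.
  rewrite (big_morph _ eD e0); apply: eq_bigr => i _.
  have := lin (c i) (pm_map (le_g i) (tagged (g i))) 0.
  by rewrite e0 !addr0 => ->; rewrite (wP (phi i)).
rewrite (partition_big phi xpredT) //=; apply: eq_bigr => j _.
by rewrite scaler_suml; apply: eq_bigr => i /eqP ->.
Qed.

Lemma spanned_by_le_betti (R : realType) (M : pmod K P) (p : P) (n : nat) :
  (forall b, spanned_by (M p) b -> (n <= b)%N) -> (n%:R%:E <= betti R 0 M)%E.
Proof.
move=> nP; rewrite /betti; case: xgetP => [_ -> [b bM <-]|_]; last first.
  by rewrite leey.
by rewrite lee_fin ler_nat; apply: nP; exact: is_betti0_spanned.
Qed.

(** The zeroth Betti number of the 0-chains is a summand of the size, and the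
    other summands are nonnegative. *)
Lemma card_vertex_le_size (R : realType) (G : sfunctor P) (p : P) :
  (#|vertex (G p)|%:R%:E <= size_of R K G)%E.
Proof.
have betti_ge0 i M : (0 <= betti R i M :> \bar R)%E.
  by rewrite /betti; case: xgetP => [_ -> [b _ <-]|_]; rewrite ?leey // lee_fin.
have h0 : (#|vertex (G p)|%:R%:E <= betti R 0 (chain_module K 0 G))%E.
  apply: (@spanned_by_le_betti R _ p) => b; exact: card_vertex_spanned.
apply: (le_trans h0); rewrite /size_of; apply: (le_trans _ (leeDr _ _)) => //.
rewrite nneseries_recl //; apply: leeDl; exact: nneseries_ge0.
Qed.

End BettiBound.

(** * Maximal simplices and crossing pairs *)

Definition maximal_simplices (W : scomplex) : {set {set vertex W}} :=
  [set s | maxset (fun t => t \in simplex W) s]%SET.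

(** A simplex comparable to a maximal simplex with k vertices is contained in
    it; if it has at least k vertices, it is equal to it. *)
Lemma maximal_simplex_isolated (W : scomplex) (k : nat)
    (v : vertex (subdivision W k)) :
  (0 < k)%N -> val v \in maximal_simplices W -> #|val v| = k ->
  isolated_vertex v.
Proof.
move=> k0; rewrite inE => /maxsetP[_ vmax] vk F.
rewrite inE => /andP[_ /forall_inP FP] vF; apply/setP => t; rewrite inE.
apply/idP/eqP => [tF|->] //; apply: val_inj.
have /andP[tW tk] := valP t.
have /forall_inP/(_ t tF)/orP[vt|tv] := FP v vF; first exact: vmax.
apply/eqP; rewrite eqEcard tv vk.
have t0 : (0 < #|val t|)%N.
  by rewrite card_gt0; apply: contraTneq tW => ->; exact: simplex0.
by move: tk; rewrite /simplex_dim -ltnS !prednK.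
Qed.

Lemma sd_vertex_maximal (W : scomplex) (k : nat) (s : {set vertex W}) :
  s \in [set s in maximal_simplices W | #|s| == k]%SET ->
  (s \in simplex W) && (k.-1 <= simplex_dim s)%N.
Proof.
by rewrite !inE => /andP[/maxsetP[-> _] /eqP <-]; exact: leqnn.
Qed.

Section ModelSize.
Variables (R : realType) (K : fieldType) (X : finite_metric_space R).
Variables (G : sfunctor (sr_index R)).
Hypothesis Gmodel :
  simplicial_model R G (realization_functor R (subdivision_rips X)).

Lemma card_maximal_le_size (r : {nonneg R}) (k : nat) : (0 < k)%N ->
  (#|[set s in maximal_simplices (rips X r) | #|s| == k]|%:R%:E <=
     size_of R K G)%E.
Proof.
move=> k0; set M := [set s in _ | _]%SET.
pose p : sr_index R := (Sub k k0, r).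
pose v (s : {s | s \in M}) : vertex (subdivision_rips X p) :=
  Sub (val s) (sd_vertex_maximal (W := rips X r) (valP s)).
have vi : injective v by move=> s t /(congr1 val) /= st; exact: val_inj.
have iv s : isolated_vertex (v s).
  have := valP s; rewrite inE => /andP[sM /eqP sk].
  exact: (@maximal_simplex_isolated (rips X r) k (v s) k0 sM sk).
have /clopen_pieces_card := (weakly_equivalent_clopen_pieces _ p Gmodel).2
  (isolated_clopen_pieces R vi iv).
rewrite card_sig => MG; apply: le_trans (card_vertex_le_size K R G p).
rewrite lee_fin ler_nat; apply: leq_trans MG.
by apply/eq_leq/eq_card => s; rewrite !inE.
Qed.

(** Pigeonhole on the number k of vertices: some k between 1 and the number of
    points accounts for a fair share of the maximal simplices. *)
Lemma maximal_simplices_le_size (r : {nonneg R}) :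
  exists N : nat, (#|maximal_simplices (rips X r)| <= #|X| * N)%N /\
    (N%:R%:E <= size_of R K G)%E.
Proof.
pose N k := #|[set s in maximal_simplices (rips X r) | #|s| == k]%SET|.
exists (\max_(k < #|X|.+1 | (0 < k)%N) N k); split; last first.
  elim/big_ind: _ => [|x y xG yG|k k0]; last exact: card_maximal_le_size.
    apply: le_trans (card_maximal_le_size r (ltn0Sn 0)).
    by rewrite lee_fin ler_nat.
  by rewrite /maxn; case: ifP.
have sizeP (s : {set X}) : (#|s| < #|X|.+1)%N by rewrite ltnS max_card.
pose size_ord s : 'I_#|X|.+1 := Ordinal (sizeP s).
rewrite -sum1_card.
rewrite (partition_big size_ord (fun k => 0 < k)%N) => [|s]; last first.
  rewrite inE => /maxsetP[sW _] /=; rewrite card_gt0.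
  by apply: contraTneq sW => ->; exact: simplex0.
apply: leq_trans (_ : \sum_(k < #|X|.+1 | (0 < k)%N)
    \max_(k < #|X|.+1 | (0 < k)%N) N k <= _)%N.
  apply: leq_sum => k k0; apply: leq_trans (leq_bigmax_cond _ k0).
  by rewrite /N -sum1_card; apply/eq_leq/eq_bigl => s; rewrite inE.
rewrite sum_nat_const leq_mul2r; apply/orP; right.
rewrite (eq_card (B := predC1 ord0)) => [|k]; first by rewrite cardC1 card_ord.
by rewrite !inE -lt0n.
Qed.

End ModelSize.

Section CrossingPairs.
Variables (R : realType) (X : finite_metric_space R) (r : {nonneg R}).
Variables (I : finType) (a b : I -> X).
Hypothesis ab : forall i j, (dist (a i) (b j) <= 2 * r%:num) = (i != j).
Hypothesis aa : forall i j, dist (a i) (a j) <= 2 * r%:num.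
Hypothesis bb : forall i j, dist (b i) (b j) <= 2 * r%:num.

(** Picking a i for i in J and b i for i outside J spans a simplex.  Extensions
    of two different choices to maximal simplices differ, as a maximal simplex
    containing both choices would contain some a i together with b i. *)
Lemma maximal_simplices_crossing : (0 < #|I|)%N ->
  (2 ^ #|I| <= #|maximal_simplices (rips X r)|)%N.
Proof.
case/card_gt0P => i0 _.
pose c (J : {set I}) : {set X} := (a @: J :|: b @: ~: J)%SET.
have cW J : c J \in simplex (rips X r).
  rewrite inE; apply/andP; split.
    apply/set0Pn; have [i0J|i0J] := boolP (i0 \in J).
      by exists (a i0); rewrite !inE imset_f.
    by exists (b i0); rewrite !inE [_ \in b @: _]imset_f ?orbT // inE.
  apply/forall_inP => x /setUP[]/imsetP[i iJ ->];
    apply/forall_inP => y /setUP[]/imsetP[j jJ ->] //.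
    by rewrite ab; apply: contraTneq iJ => ->; move: jJ; rewrite inE.
  by rewrite dist_sym ab; apply: contraTneq jJ => ->; move: iJ; rewrite inE.
have cM J : exists t : {set X},
    (t \in maximal_simplices (rips X r)) && (c J \subset t).
  have [t tm ct] :=
    @maxset_exists _ (fun t => t \in simplex (rips X r)) _ (cW J).
  by exists t; rewrite inE tm ct.
pose m J := xchoose (cM J).
have mi : injective m.
  move=> J J' JJ'; apply/setP => i.
  have /andP[m1 c1] := xchooseP (cM J); have /andP[m2 c2] := xchooseP (cM J').
  have : m J \in simplex (rips X r) by move: m1; rewrite inE => /maxsetP[].
  rewrite inE => /andP[_ /forall_inP mW].
  have clash : a i \in m J -> b i \in m J -> False.
    by move=> am bm; have /forall_inP/(_ _ bm) := mW _ am; rewrite ab eqxx.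
  have iJ (L : {set I}) : m L = m J -> c L \subset m L ->
      if i \in L then a i \in m J else b i \in m J.
    move=> <- /fintype.subsetP cL; have [iL|iL] := boolP (i \in L); apply: cL.
      by rewrite !inE imset_f.
    by rewrite !inE [_ \in b @: _]imset_f ?orbT // inE.
  have := iJ J erefl c1; have := iJ J' (esym JJ') c2.
  by case: (i \in J); case: (i \in J') => // h1 h2; case: clash.
rewrite -[#|I|]cardsT -card_powerset.
rewrite -(card_imset _ mi); apply: subset_leq_card.
apply/fintype.subsetP => _ /imsetP[J _ ->].
by have /andP[] := xchooseP (cM J).
Qed.

End CrossingPairs.

(** The form in which both parts use the count of maximal simplices; s is twice
    the scale of the Rips complex. *)
Lemma crossing_pairs_le_size (R : realType) (K : fieldType)
    (X : finite_metric_space R) (G : sfunctor (sr_index R)) (s : R)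
    (I : finType) (a b : I -> X) (L : R) :
  simplicial_model R G (realization_functor R (subdivision_rips X)) ->
  0 <= s ->
  (forall i j, (dist (a i) (b j) <= s) = (i != j)) ->
  (forall i j, dist (a i) (a j) <= s) ->
  (forall i j, dist (b i) (b j) <= s) ->
  (0 < #|I|)%N -> L * #|X|%:R <= 2 ^+ #|I| ->
  (L%:E <= size_of R K G)%E.
Proof.
move=> GX s0 ab aa bb I0 LX.
have r0 : 0 <= s / 2 by rewrite divr_ge0.
pose r : {nonneg R} := NngNum r0.
have rE : 2 * r%:num = s by rewrite /= mulrC divfK.
have [N [XN NG]] := maximal_simplices_le_size K GX r.
apply: le_trans NG; rewrite lee_fin.
have X0 : 0 < #|X|%:R :> R.
  by case/card_gt0P: I0 => i _; rewrite ltr0n; apply/card_gt0P; exists (a i).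
rewrite -(ler_pM2r X0) -natrM mulnC; apply: (le_trans LX).
rewrite -natrX ler_nat; apply: leq_trans XN.
by apply: (maximal_simplices_crossing (a := a) (b := b)); rewrite ?rE.
Qed.

(** * Exponentials against polynomials *)

(** With M = (k + 1) q + r, the power 2 ^ M is at least
    (2 ^ q) ^ (k + 1) >= (q + 1) ^ (k + 1), a polynomial of degree larger
    than k in M. *)
Lemma poly_le_exp2 (A k : nat) :
  exists N, forall M, (N <= M)%N -> (A * M.+1 ^ k <= 2 ^ M)%N.
Proof.
(* The threshold makes the quotient q at least A (k + 1) ^ k. *)
exists (k.+1 * (A * k.+1 ^ k))%N => M NM.
set q := (M %/ k.+1)%N.
have qM : (M < k.+1 * q.+1)%N by rewrite mulnC ltn_ceil.
have qA : (A * k.+1 ^ k <= q)%N by rewrite leq_divRL // mulnC.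
apply: (@leq_trans (A * (k.+1 * q.+1) ^ k)).
  case: (posnP k) => [->|k0]; first by rewrite !expn0.
  by rewrite leq_mul2l leq_exp2r ?qM ?orbT.
rewrite expnMn mulnA; apply: (@leq_trans (q.+1 ^ k.+1)).
  by rewrite expnS leq_mul2r (leq_trans qA) ?orbT.
apply: (@leq_trans ((2 ^ q) ^ k.+1)); first by rewrite leq_exp2r // ltn_expl.
by rewrite -expnM leq_exp2l // leq_divM.
Qed.

(** * Points on the circle *)

Section Circle.
Variables (R : realType) (K : fieldType).

(** The squared distance between points k steps apart is 2 - 2 step_cos n k, so
    comparing distances amounts to comparing these cosines. *)
Definition step_cos (n k : nat) : R := cos (2 * pi * k%:R / n%:R).

Lemma step_cos_rev (n k : nat) : (0 < n)%N -> (k <= n)%N ->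
  step_cos n (n - k) = step_cos n k.
Proof.
move=> n0 kn; rewrite /step_cos natrB //.
have nz : n%:R != 0 :> R by rewrite pnatr_eq0 -lt0n.
have -> : 2 * pi * (n%:R - k%:R) / n%:R =
    - (2 * pi * k%:R / n%:R) + pi *+ 2 :> R.
  by rewrite -mulr_natl; field.
by rewrite cosD2pi cosN.
Qed.

Lemma step_cos_lt (n k l : nat) : (k < l)%N -> (2 * l <= n)%N ->
  step_cos n l < step_cos n k.
Proof.
move=> kl ln.
have n0 : 0 < n%:R :> R by rewrite ltr0n; lia.
have in0pi m : (2 * m <= n)%N -> 2 * pi * m%:R / n%:R \in `[0 : R, pi].
  move=> mn; rewrite in_itv /=; apply/andP; split.
    by rewrite !mulr_ge0 ?invr_ge0 ?pi_ge0 // ltW.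
  rewrite ler_pdivrMr // [2 * pi]mulrC -mulrA ler_wpM2l ?pi_ge0 //.
  by rewrite -natrM ler_nat.
rewrite ltr_cos ?in0pi //; last by lia.
by rewrite ltr_pM2r ?invr_gt0 // ltr_pM2l ?mulr_gt0 ?pi_gt0 // ltr_nat.
Qed.

Lemma l2_dist_circle (u v : R) :
  l2_dist (cos u, sin u) (cos v, sin v) = Num.sqrt (2 - 2 * cos (u - v)).
Proof.
rewrite /l2_dist /= cosB; congr Num.sqrt.
have := cos2Dsin2 u; have := cos2Dsin2 v; nra.
Qed.

(** Put h = n / 2, a_i the point of index 2 i and b_i the point of index
    2 i + h, for 2 i < h.  Steps between points of the same family are less
    than h, and the step from a_i to b_j is h + 2 (j - i).  The far steps are
    h and n - h, which is h or h + 1, so the even difference 2 (j - i) makes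
    the step far only for i = j.  This works for both parities of n. *)
Lemma circle_model_size (n : nat) (t : R) (G : sfunctor (sr_index R)) (L : R) :
  (4 <= n)%N ->
  simplicial_model R G
    (realization_functor R (subdivision_rips (planar (circle_points t n)))) ->
  0 <= L -> L * n%:R <= 2 ^+ (n %/ 4) -> (L%:E <= size_of R K G)%E.
Proof.
move=> n4 GX L0 Ln; set X := circle_points t n in GX.
pose angle k : R := t + 2 * pi * k%:R / n%:R.
have ptX (k : 'I_n) : (cos (angle k), sin (angle k)) \in X.
  by apply/imfsetP; exists k.
pose pt (k : 'I_n) : planar X := [` ptX k]%fset.
have dist_pt (k l : 'I_n) : (k <= l)%N ->
    dist (pt k) (pt l) = Num.sqrt (2 - 2 * step_cos n (l - k)).
  move=> kl; rewrite [LHS]l2_dist_circle /step_cos natrB //.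
  rewrite -[in RHS]cosN; congr (Num.sqrt (2 - 2 * cos _)).
  by rewrite /angle; ring.
pose h := (n %/ 2)%N.
have [hn1 hn2] : (2 * h <= n)%N /\ (n <= 2 * h + 1)%N by rewrite /h; lia.
(* The largest distance between points less than h steps apart. *)
pose far : R := Num.sqrt (2 - 2 * step_cos n h.-1).
have farE k : (Num.sqrt (2 - 2 * step_cos n k) <= far) =
    (step_cos n h.-1 <= step_cos n k).
  rewrite ler_sqrt ?lerD2l ?lerN2 ?ler_pM2l //.
  by rewrite subr_ge0 -[leRHS]mulr1 ler_pM2l // cos_le1.
have near k : (k < h)%N -> step_cos n h.-1 <= step_cos n k.
  move=> kh; have [->|kh'] := eqVneq k h.-1; first exact: lexx.
  by apply/ltW/step_cos_lt; lia.
have nearE k : (k <= n)%N -> (k < h)%N || (h.+1 < k)%N || (k == h) ->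
    (step_cos n h.-1 <= step_cos n k) = (k != h).
  move=> kn; have [->|kh] /= := eqVneq k h.
    by move=> _; apply/negbTE; rewrite -ltNge; apply: step_cos_lt; lia.
  rewrite orbF => /orP[?|?]; first by rewrite near.
  by rewrite -(@step_cos_rev n k) ?near //; lia.
have aP (i : 'I_(n %/ 4)) : (2 * i < n)%N by have := ltn_ord i; lia.
have bP (i : 'I_(n %/ 4)) : (2 * i + h < n)%N by have := ltn_ord i; lia.
pose a i := pt (Ordinal (aP i)); pose b i := pt (Ordinal (bP i)).
apply: (@crossing_pairs_le_size R K (planar X) G far _ a b L GX).
- exact: sqrtr_ge0.
- move=> i j; have iP := ltn_ord i; have jP := ltn_ord j.
  rewrite dist_pt /=; last by lia.
  rewrite farE nearE; try by lia.
  by rewrite -(inj_eq val_inj) /=; lia.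
- move=> i j; wlog ij : i j / (i <= j)%N.
    by move=> H; have [|/ltnW] := leqP i j; [|rewrite dist_sym]; apply: H.
  have jP := ltn_ord j.
  rewrite dist_pt /=; last by lia.
  by rewrite farE near //; lia.
- move=> i j; wlog ij : i j / (i <= j)%N.
    by move=> H; have [|/ltnW] := leqP i j; [|rewrite dist_sym]; apply: H.
  have jP := ltn_ord j.
  rewrite dist_pt /=; last by lia.
  by rewrite farE near //; lia.
- by rewrite card_ord; lia.
rewrite card_ord; apply: le_trans Ln; rewrite ler_wpM2l // ler_nat.
rewrite -cardfE; apply: leq_trans (leq_imfset_card _ _ _) _.
by rewrite -cardE card_ord.
Qed.

Lemma circle_size_exponential : exists (c : R) (n0 : nat), 0 < c /\
     forall (n : nat) (t : R) (G : sfunctor (sr_index R)),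
       (n0 <= n)%N ->
       simplicial_model R G
         (realization_functor R
           (subdivision_rips (planar (circle_points t n)))) ->
       ((expR (c * n%:R))%:E <= size_of R K G)%E.
Proof.
have [N NP] := poly_le_exp2 32 2.
have ln2 : 0 < ln 2 :> R by rewrite ln_gt0 // ltr1n.
exists (ln 2 / 8), (4 * N.+1)%N; split; first by rewrite divr_gt0.
move=> n t G nN GX; have n4 : (4 <= n)%N by lia.
apply: (circle_model_size n4 GX (expR_ge0 _)).
set m := (n %/ 4)%N.
have Nm : (N <= m)%N by rewrite /m; lia.
have nm : (n <= 4 * m.+1)%N by rewrite /m; lia.
rewrite -(@ler_pXn2r _ 2) ?nnegrE ?mulr_ge0 ?expR_ge0 ?exprn_ge0 //.
rewrite exprMn -exprM -expRM_natr.
have E2 : expR (ln 2 / 8 * n%:R * 2) <= 2 ^+ m.+1 :> R.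
  rewrite -[X in X ^+ _](@lnK R) ?posrE // -expRM_natr ler_expR.
  have : n%:R <= 4 * m.+1%:R :> R by rewrite -natrM ler_nat.
  by move: ln2; set l := ln 2; set x := n%:R; set y := m.+1%:R; nra.
apply: le_trans (ler_wpM2r _ E2) _; first by rewrite exprn_ge0.
rewrite -!natrX -natrM ler_nat.
have n2 : (n ^ 2 <= 16 * m.+1 ^ 2)%N.
  by rewrite (_ : 16 = 4 ^ 2)%N // -expnMn leq_exp2r.
apply: (@leq_trans (2 ^ m * (32 * m.+1 ^ 2))).
  rewrite expnSr (_ : 32 = 2 * 16)%N // -!mulnA !leq_pmul2l ?expn_gt0 //.
by rewrite muln2 -addnn expnD leq_mul2l NP ?orbT.
Qed.

End Circle.

(** * Two opposite arcs of a circle *)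

Section ArcGeometry.
Variables (R : realFieldType).
Implicit Types s t y z w e : R.

(** On the arcs of the circle of radius 1/2 with abscissa between 0 and 1/4,
    the ordinate is at least 1/4, and so it is at least as large as the
    abscissa and is a 1-Lipschitz function of it. *)
Lemma arc_lipschitz s t y z : 0 <= s <= 4^-1 -> 0 <= t <= 4^-1 ->
  0 <= y -> 0 <= z -> y ^+ 2 = 4^-1 - s ^+ 2 -> z ^+ 2 = 4^-1 - t ^+ 2 ->
  [/\ 4^-1 <= y <= 2^-1, 4^-1 <= z <= 2^-1 & (y - z) ^+ 2 <= (s - t) ^+ 2].
Proof.
move=> /andP[s0 s1] /andP[t0 t1] y0 z0 ys zt.
have half w r : 0 <= w -> 0 <= r <= 4^-1 -> w ^+ 2 = 4^-1 - r ^+ 2 ->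
    4^-1 <= w <= 2^-1.
  move=> w0 /andP[r0 r1] wr; apply/andP; split.
    by rewrite -(@ler_pXn2r _ 2) ?nnegrE ?invr_ge0 // wr; nra.
  by rewrite -(@ler_pXn2r _ 2) ?nnegrE ?invr_ge0 // wr; nra.
have [y1 z1] : 4^-1 <= y <= 2^-1 /\ 4^-1 <= z <= 2^-1.
  by split; [apply: (half _ s) | apply: (half _ t)]; rewrite // ?s0 ?t0.
split => //.
have [/andP[y2 _] /andP[z2 _]] := (y1, z1).
have e : (y - z) * (y + z) = (t - s) * (t + s) by nra.
have yz0 : 0 < (y + z) ^+ 2 by nra.
rewrite -(ler_pM2r yz0) -exprMn e exprMn -[X in X * _]sqrrN opprB.
by apply: ler_wpM2l; [exact: sqr_ge0 | nra].
Qed.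

(** For w = 0 this is the theorem of Thales: the antipode of one point, the
    other point and the first one form a right triangle on a diameter of
    length 1.  The number w is the total inward displacement. *)
Lemma opposite_arcs_sqdist s t y z w :
  y ^+ 2 = 4^-1 - s ^+ 2 -> z ^+ 2 = 4^-1 - t ^+ 2 ->
  (s + t) ^+ 2 + (y + z - w) ^+ 2 =
  1 - (s - t) ^+ 2 - (y - z) ^+ 2 - 2 * (y + z) * w + w ^+ 2.
Proof. by move=> ys zt; nra. Qed.

(** Two squares of size at most e ^ 2 each and a displacement term of at most
    e ^ 2 are subtracted from 1. *)
Lemma opposite_arcs_far s t y z w e : 0 < e -> `|s - t| <= e ->
  0 <= s <= 4^-1 -> 0 <= t <= 4^-1 -> 0 <= y -> 0 <= z ->
  y ^+ 2 = 4^-1 - s ^+ 2 -> z ^+ 2 = 4^-1 - t ^+ 2 -> 0 <= w <= e ^+ 2 / 2 ->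
  1 - 4 * e ^+ 2 < (s + t) ^+ 2 + (y + z - w) ^+ 2.
Proof.
move=> e0 ste s01 t01 y0 z0 ys zt /andP[w0 w1].
have [/andP[y1 y2] /andP[z1 z2] yzst] := arc_lipschitz s01 t01 y0 z0 ys zt.
rewrite (opposite_arcs_sqdist w ys zt).
have st2 : (s - t) ^+ 2 <= e ^+ 2.
  by rewrite -real_normK ?num_real // ler_pXn2r ?nnegrE // ltW.
have : (y + z) * w <= w by rewrite -[leRHS]mul1r ler_wpM2r //; lra.
have := sqr_ge0 w; have : 0 < e ^+ 2 by rewrite exprn_gt0.
lra.
Qed.

(** The square (s - t) ^ 2 alone accounts for 4 e ^ 2; an inward displacement
    only brings the points closer. *)
Lemma opposite_arcs_near s t y z w e : 0 < e -> 2 * e <= `|s - t| ->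
  0 <= s <= 4^-1 -> 0 <= t <= 4^-1 -> 0 <= y -> 0 <= z ->
  y ^+ 2 = 4^-1 - s ^+ 2 -> z ^+ 2 = 4^-1 - t ^+ 2 -> 0 <= w <= 1 ->
  (s + t) ^+ 2 + (y + z - w) ^+ 2 <= 1 - 4 * e ^+ 2.
Proof.
move=> e0 ste s01 t01 y0 z0 ys zt /andP[w0 w1].
have [/andP[y1 y2] /andP[z1 z2] _] := arc_lipschitz s01 t01 y0 z0 ys zt.
rewrite (opposite_arcs_sqdist w ys zt).
have st2 : (2 * e) ^+ 2 <= (s - t) ^+ 2.
  by rewrite -[leRHS]real_normK ?num_real // ler_pXn2r ?nnegrE //; lra.
have : w * w <= 2 * (y + z) * w by rewrite ler_wpM2r //; lra.
have := sqr_ge0 (y - z); lra.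
Qed.

Lemma same_arc_near s t y z w e : 0 < e <= 12^-1 ->
  0 <= s <= 4^-1 -> 0 <= t <= 4^-1 -> 0 <= y -> 0 <= z ->
  y ^+ 2 = 4^-1 - s ^+ 2 -> z ^+ 2 = 4^-1 - t ^+ 2 -> `|w| <= 12^-1 ->
  (s - t) ^+ 2 + (y - z + w) ^+ 2 <= 1 - 4 * e ^+ 2.
Proof.
move=> /andP[e0 e1] s01 t01 y0 z0 ys zt; rewrite ler_norml => /andP[w0 w1].
have [/andP[y1 y2] /andP[z1 z2] _] := arc_lipschitz s01 t01 y0 z0 ys zt.
move: s01 t01 => /andP[s0 s1] /andP[t0 t1].
nra.
Qed.

End ArcGeometry.

(** * Boxes along opposite arcs *)

Section Boxes.
Variables (R : realType) (M : nat).
Hypothesis M0 : (0 < M)%N.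

Definition semicircle (s : R) : R := Num.sqrt (4^-1 - s ^+ 2).

Definition strip (a e h : R) (f : R -> R) : set (R * R) :=
  [set p | (a <= p.1 <= a + e) && (f p.1 <= p.2 <= f p.1 + h)].

(** Consecutive boxes start 3 widths apart, so that M of them fit between the
    abscissas 0 and 1/4. *)
Definition box_width : R := (12 * M%:R)^-1.

(** Small enough for the height not to blur the effect, of order box_width ^ 2,
    of an angle between two pieces of arc. *)
Definition box_height : R := box_width ^+ 2 / 4.

Definition box_left (b : bool) (j : nat) : R :=
  if b then 2^-1 - 3 * box_width * j%:R - box_width
  else 2^-1 + 3 * box_width * j%:R.

Definition box_floor (b : bool) (x : R) : R :=
  if b then 2^-1 + semicircle (x - 2^-1) - box_height
  else 2^-1 - semicircle (x - 2^-1).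

(** The boxes with b = false follow the lower arc of the circle of diameter 1
    about the centre of the unit square, on the inside; the box with b = true
    and the same j is its reflection in the centre. *)
Definition box (b : bool) (j : nat) : set (R * R) :=
  strip (box_left b j) box_width box_height (box_floor b).

Lemma box_width_bounds : 0 < box_width <= 12^-1.
Proof.
have M1 : 1 <= M%:R :> R by rewrite ler1n.
rewrite /box_width invr_gt0 lef_pV2 ?posrE ?mulr_gt0 ?ltr0n //.
by rewrite ler_pMr.
Qed.

Lemma box_widthM (j : nat) : (j < M)%N ->
  3 * box_width * j%:R + 3 * box_width <= 4^-1.
Proof.
move=> jM; have jM1 : j%:R + 1 <= M%:R :> R by rewrite natr1 ler_nat.
have M1 : 0 < M%:R :> R by rewrite ltr0n.
have /andP[e0 _] := box_width_bounds.
have : box_width * M%:R = 12^-1 by rewrite /box_width; field; rewrite gt_eqF.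
have : box_width * (j%:R + 1) <= box_width * M%:R by rewrite ler_pM2l.
lra.
Qed.

Lemma sqr_semicircle (s : R) : 0 <= s <= 4^-1 ->
  semicircle s ^+ 2 = 4^-1 - s ^+ 2.
Proof. by move=> /andP[s0 s1]; rewrite sqr_sqrtr //; nra. Qed.

Lemma semicircleN (s : R) : semicircle (- s) = semicircle s.
Proof. by rewrite /semicircle sqrrN. Qed.

(** Both families are described by the same two numbers, the distance s of the
    abscissa from that of the centre and the inward vertical displacement u
    from the circle. *)
Lemma box_coord (b : bool) (j : nat) (p : R * R) : (j < M)%N -> box b j p ->
  exists s u, [/\ 0 <= s <= 4^-1,
    3 * box_width * j%:R <= s <= 3 * box_width * j%:R + box_width,
    0 <= u <= box_height
    & p = if b then (2^-1 - s, 2^-1 + semicircle s - u)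
          else (2^-1 + s, 2^-1 - semicircle s + u)].
Proof.
move=> jM; have /andP[e0 _] := box_width_bounds; have := box_widthM jM.
have : 0 <= 3 * box_width * j%:R by rewrite !mulr_ge0 // ltW.
rewrite /box /strip /= /box_left /box_floor; case: p => x y /=.
set c := 3 * _ * _; move=> c0 c1; case: b => /andP[/andP[x1 x2] /andP[y1 y2]].
  exists (2^-1 - x), (2^-1 + semicircle (x - 2^-1) - y); split.
  - by apply/andP; split; lra.
  - by apply/andP; split; lra.
  - by apply/andP; split; lra.
  - by rewrite -[semicircle (2^-1 - x)]semicircleN opprB; congr (_, _); ring.
exists (x - 2^-1), (y - 2^-1 + semicircle (x - 2^-1)); split.
- by apply/andP; split; lra.
- by apply/andP; split; lra.
- by apply/andP; split; lra.
- by congr (_, _); ring.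
Qed.

Lemma semicircle_ge0 s : 0 <= semicircle s.
Proof. exact: sqrtr_ge0. Qed.

(** Points of opposite boxes differ by at most one width in their parameters s;
    for points on opposite arcs in boxes with different numbers, the
    parameters differ by at least two widths. *)
Lemma box_dist (b b' : bool) (i j : nat) (p q : R * R) :
  (i < M)%N -> (j < M)%N -> box b i p -> box b' j q ->
  (l2_dist p q <= Num.sqrt (1 - 4 * box_width ^+ 2)) =
  ~~ ((b != b') && (i == j)).
Proof.
wlog : b b' i j p q / (b <= b')%N.
  move=> H iM jM pi qj; have [bb|bb] := boolP (b <= b')%N; first exact: H.
  rewrite l2_dist_sym (H b' b j i q p) //.
    by rewrite eq_sym [j == i]eq_sym.
  by move: bb; case: (b); case: (b').
move=> bb iM jM /(box_coord iM)[s [u [s01 si u01 ->]]].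
move=> /(box_coord jM)[t [v [t01 tj v01 ->]]].
have e01 := box_width_bounds; have /andP[e0 e1] := e01.
have h01 : box_height <= 24^-1 by rewrite /box_height; nra.
have [ys yt] := (sqr_semicircle s01, sqr_semicircle t01).
have thr0 : 0 <= 1 - 4 * box_width ^+ 2 by nra.
rewrite /l2_dist ler_sqrt //; move: bb; case: b; case: b' => //= _.
- have w1 : `|v - u| <= 12^-1 by rewrite ler_norml; apply/andP; split; lra.
  have := same_arc_near e01 s01 t01 (semicircle_ge0 s) (semicircle_ge0 t)
    ys yt w1.
  by congr (is_true (_ <= _)) => /=; ring.
- have uv : 0 <= u + v by lra.
  rewrite (_ : _ + _ =
    (s + t) ^+ 2 + (semicircle s + semicircle t - (u + v)) ^+ 2); last first.
    by rewrite /=; ring.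
  have [ij|ij] := eqVneq i j.
    apply/negbTE; rewrite -ltNge.
    apply: opposite_arcs_far => //; try exact: semicircle_ge0.
      by rewrite ler_norml; move: si tj; rewrite ij; lra.
    by rewrite uv; rewrite /box_height in u01 v01; lra.
  apply: opposite_arcs_near => //; try exact: semicircle_ge0; last by lra.
  have step (a c : nat) (x y : R) : (a < c)%N ->
      3 * box_width * a%:R <= x <= 3 * box_width * a%:R + box_width ->
      3 * box_width * c%:R <= y <= 3 * box_width * c%:R + box_width ->
      2 * box_width <= y - x.
    move=> ac; have : a%:R + 1 <= c%:R :> R by rewrite natr1 ler_nat.
    by rewrite -(ler_pM2l e0); lra.
  have [ij'|ij'|ij'] := ltngtP i j; last by rewrite ij' eqxx in ij.
    by rewrite distrC; apply: le_trans (ler_norm _); exact: step ij' si tj.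
  by apply: le_trans (ler_norm _); exact: step ij' tj si.
- have w1 : `|v - u| <= 12^-1 by rewrite ler_norml; apply/andP; split; lra.
  have := same_arc_near e01 s01 t01 (semicircle_ge0 s) (semicircle_ge0 t)
    ys yt w1.
  by congr (is_true (_ <= _)) => /=; ring.
Qed.

Lemma box_disjoint (b b' : bool) (i j : nat) (p : R * R) :
  (i < M)%N -> (j < M)%N -> box b i p -> box b' j p -> (b, i) = (b', j).
Proof.
have /andP[e0 e1] := box_width_bounds.
have h01 : box_height <= 24^-1 by rewrite /box_height; nra.
move=> iM jM /(box_coord iM)[s [u [s01 si u01 ->]]].
move=> /(box_coord jM)[t [v [t01 tj v01]]].
have [/andP[y1 y2] /andP[z1 z2] _] := arc_lipschitz s01 t01 (semicircle_ge0 s)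
  (semicircle_ge0 t) (sqr_semicircle s01) (sqr_semicircle t01).
have le a c (x y : R) : x = y ->
    3 * box_width * a%:R <= x <= 3 * box_width * a%:R + box_width ->
    3 * box_width * c%:R <= y <= 3 * box_width * c%:R + box_width ->
    (a <= c)%N.
  move=> xy xa yc; rewrite leqNgt; apply/negP => ca.
  have : c%:R + 1 <= a%:R :> R by rewrite natr1 ler_nat.
  by rewrite -(ler_pM2l e0); lra.
case: b; case: b' => -[xx yy]; try by exfalso; lra.
  have st : s = t by lra.
  by congr pair; apply/eqP; rewrite eqn_leq (le i j s t) ?(le j i t s).
have st : s = t by lra.
by congr pair; apply/eqP; rewrite eqn_leq (le i j s t) ?(le j i t s).
Qed.

Lemma box_square (b : bool) (j : nat) : (j < M)%N ->
  box b j `<=` `[0, 1] `*` `[0, 1].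
Proof.
have /andP[e0 e1] := box_width_bounds.
have h01 : box_height <= 24^-1 by rewrite /box_height; nra.
move=> jM p /(box_coord jM)[s [u [s01 sj u01 ->]]].
have [/andP[y1 y2] _ _] := arc_lipschitz s01 s01 (semicircle_ge0 s)
  (semicircle_ge0 s) (sqr_semicircle s01) (sqr_semicircle s01).
by case: b => /=; split => /=; rewrite in_itv /=; apply/andP; split; lra.
Qed.

Lemma square_model_size (K : fieldType) (X : {fset (R * R)%type})
    (G : sfunctor (sr_index R)) (L : R) (J : {set 'I_M}) :
  simplicial_model R G (realization_functor R (subdivision_rips (planar X))) ->
  (forall b j, j \in J -> exists2 p, p \in X & box b j p) ->
  (0 < #|J|)%N -> L * #|` X|%:R <= 2 ^+ #|J| -> (L%:E <= size_of R K G)%E.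
Proof.
move=> GX JX J0 LX.
have ptP b (j : {j | j \in J}) : exists p : planar X, box b (val j) (val p).
  by have [p pX pj] := JX b _ (valP j); exists [` pX]%fset.
have [pt0 pt0P] := boolp.choice (ptP false).
have [pt1 pt1P] := boolp.choice (ptP true).
apply: (@crossing_pairs_le_size R K (planar X) G
  (Num.sqrt (1 - 4 * box_width ^+ 2)) _ pt0 pt1 L GX).
- exact: sqrtr_ge0.
- move=> i j; rewrite (box_dist _ _ (pt0P i) (pt1P j)) //=.
- move=> i j; rewrite (box_dist _ _ (pt0P i) (pt0P j)) //=.
- move=> i j; rewrite (box_dist _ _ (pt1P i) (pt1P j)) //=.
- by rewrite card_sig.
by rewrite card_sig -cardfE.
Qed.

End Boxes.

(** * Area of a strip *)

Section StripMeasure.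
Variables (R : realType).
Local Notation plane := (measurableTypeR R * measurableTypeR R)%type.

Lemma measurable_strip (a e h : R) (f : R -> R) :
  measurable_fun [set: R] f -> measurable (strip a e h f : set plane).
Proof.
move=> mf.
have mi (x y : R) (g : plane -> R) : measurable_fun setT g ->
    measurable [set p | x <= g p <= y].
  move=> mg; have := mg measurableT _ (measurable_itv `[x, y]).
  by rewrite setTI; congr measurable;
    apply/seteqP; split => p /=; rewrite in_itv.
have mfst : measurable_fun [set: plane] (fst : plane -> R).
  exact: measurable_fst.
have msnd : measurable_fun [set: plane] (snd : plane -> R).
  exact: measurable_snd.
have mdiff : measurable_fun [set: plane] (fun p : plane => (p.2 : R) - f p.1).
  by apply: measurable_funB => //; exact: measurableT_comp.
have -> : strip a e h f = [set p : plane | a <= (p.1 : R) <= a + e] `&`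
    [set p : plane | 0 <= (p.2 : R) - f p.1 <= h].
  apply/seteqP; split => -[x y]; rewrite /strip /=.
    move=> /andP[xa /andP[y1 y2]].
    by split; [exact: xa | apply/andP; split; lra].
  by move=> [-> /andP[y1 y2]]; apply/andP; split; lra.
by apply: measurableI; exact: mi.
Qed.

(** All nonempty vertical sections are intervals of length h. *)
Lemma strip_measure (a e h : R) (f : R -> R) : 0 <= e -> 0 <= h ->
  measurable_fun [set: R] f ->
  (lebesgue_measure \x lebesgue_measure)%E (strip a e h f : set plane) =
  (e * h)%:E.
Proof.
move=> e0 h0 mf; rewrite /product_measure1 /=.
have len (x l : R) : 0 <= l ->
    lebesgue_measure (`[x, x + l]%classic : set (measurableTypeR R)) = l%:E.
  move=> l0; rewrite lebesgue_measure_itv /= lte_fin.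
  case: ltP => [_|]; first by rewrite -EFinB addrAC subrr add0r.
  by rewrite gerDl => l1; congr _%:E; apply/le_anti/andP.
pose base : set (measurableTypeR R) := `[a, (a + e)%R]%classic.
transitivity (\int[lebesgue_measure]_(x in base) cst h%:E x)%E.
  rewrite [RHS]integral_mkcond; apply: eq_integral => x _.
  rewrite patchE /base /=.
  case: ifPn => [|]; rewrite ?inE ?notin_setE /= in_itv /=.
    move=> xa; rewrite -(len (f x) h h0); congr (lebesgue_measure _).
    apply/seteqP; split => y;
      by rewrite /xsection /strip /= in_setE /= xa /= in_itv.
  move=> xa; rewrite (_ : xsection _ _ = set0) ?measure0 //.
  apply/seteqP; split => y //; rewrite /xsection /strip /= in_setE /=.
  by move=> /andP[].
rewrite integral_cst; last exact: measurable_itv.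
by rewrite mulrC EFinM; congr (_ * _)%E; exact: len.
Qed.

End StripMeasure.

(** * Random samples that fill the boxes *)

Section BoxMeasure.
Variables (R : realType) (M : nat).
Hypothesis M0 : (0 < M)%N.
Local Notation plane := (measurableTypeR R * measurableTypeR R)%type.

Definition box_area : R := box_width R M * box_height R M.

Lemma measurable_box_floor b : measurable_fun [set: R] (@box_floor R M b).
Proof.
apply: continuous_measurable_fun => x.
have cx : (fun y : R => y - 2^-1) @ x --> x - 2^-1.
  by apply: cvgB; [exact: cvg_id | exact: cvg_cst].
have ca : (fun y : R => semicircle (y - 2^-1)) @ x --> semicircle (x - 2^-1).
  apply: (@cvg_comp _ _ _ (fun y : R => 4^-1 - (y - 2^-1) ^+ 2) Num.sqrt);
    last exact: sqrt_continuous.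
  by apply: cvgB; [exact: cvg_cst | exact: cvgM].
rewrite /box_floor; case: b.
  apply: cvgB; last exact: cvg_cst.
  by apply: cvgD => //; exact: cvg_cst.
by apply: cvgB => //; exact: cvg_cst.
Qed.

Lemma measurable_box b j : measurable (@box R M b j : set plane).
Proof. by apply: measurable_strip; exact: measurable_box_floor. Qed.

Definition boxes (S : {set bool * 'I_M}) : set plane :=
  \bigcup_(s in [set` enum S]) box M s.1 s.2.

Lemma boxesP S p : boxes S p <-> exists2 s, s \in S & box M s.1 s.2 p.
Proof.
split=> [[s /= sS ps]|[s sS ps]]; exists s => //; first by rewrite -mem_enum.
by rewrite /= mem_enum.
Qed.

Lemma measurable_boxes S : measurable (boxes S).
Proof.
apply: fin_bigcup_measurable => // s _; exact: measurable_box.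
Qed.

Lemma box_measure b j :
  (lebesgue_measure \x lebesgue_measure)%E (@box R M b j : set plane) =
  box_area%:E.
Proof.
have /andP[e0 _] := box_width_bounds R M0.
apply: strip_measure; [exact: ltW | | exact: measurable_box_floor].
by rewrite /box_height divr_ge0 // exprn_ge0 // ltW.
Qed.

Lemma boxes_measure S :
  (lebesgue_measure \x lebesgue_measure)%E (boxes S) =
  (#|S|%:R * box_area)%:E.
Proof.
rewrite measure_fin_bigcup //; last by move=> s _; exact: measurable_box.
  rewrite -(fsbig_seq _ _ (enum_uniq S)).
  transitivity (\sum_(s <- enum S) box_area%:E)%E.
    by apply: eq_bigr => s _; exact: box_measure.
  by rewrite sumEFin big_enum sumr_const mulr_natl.
move=> s t _ _ [p [ps pt]].
have := box_disjoint M0 (ltn_ord s.2) (ltn_ord t.2) ps pt.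
by case: s t {ps pt} => b i [c j] /= [-> /val_inj ->].
Qed.

Lemma boxes_square S : boxes S `<=` `[0%R, 1%R] `*` `[0%R, 1%R].
Proof.
by move=> p /boxesP[s _ ps]; apply: (box_square M0 (ltn_ord s.2) ps).
Qed.

Lemma box_area_bounds : 0 <= box_area /\ 2 * M%:R * box_area <= 1.
Proof.
have e01 := box_width_bounds R M0; have /andP[e0 e1] := e01.
have M1 : 0 < M%:R :> R by rewrite ltr0n.
have eM : box_width R M * M%:R = 12^-1.
  by rewrite /box_width; field; rewrite gt_eqF.
have h0 : 0 <= box_height R M.
  by rewrite /box_height divr_ge0 // exprn_ge0 // ltW.
have h1 : box_height R M <= 1 by rewrite /box_height; nra.
split; first by rewrite /box_area mulr_ge0 // ltW.
rewrite /box_area (_ : _ * _ = 2 * (box_width R M * M%:R) * box_height R M).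
  by rewrite eM; lra.
by ring.
Qed.

End BoxMeasure.

(** The union bound, with the cardinal of the index type as a crude count of
    the events. *)
Lemma finite_union_bound (d : measure_display) (T : measurableType d)
    (R : realType) (Pr : probability T R) (I : finType) (P : pred I)
    (A : I -> set T) (e : R) :
  (forall i, P i -> measurable (A i)) ->
  (forall i, P i -> (Pr (A i) <= e%:E)%E) ->
  0 <= e ->
  measurable (\big[setU/set0]_(i | P i) A i) /\
  (Pr (\big[setU/set0]_(i | P i) A i) <= (#|I|%:R * e)%:E)%E.
Proof.
move=> mA Ae e0.
suff [mU PU] : measurable (\big[setU/set0]_(i | P i) A i) /\
    (Pr (\big[setU/set0]_(i | P i) A i) <= (\sum_(i | P i) e)%:E)%E.
  split=> //; apply: (le_trans PU).
  rewrite lee_fin sumr_const -[leLHS]mulr_natl.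
  by rewrite ler_wpM2r // ler_nat max_card.
elim/big_ind2: _ => [|B u C v [mB Bu] [mC Cv]|i Pi].
- by rewrite measure0; split.
- split; first exact: measurableU.
  by apply: le_trans (measureU2 _ mB mC) _; rewrite EFinD leeD.
- by split; [exact: mA | exact: Ae].
Qed.

Section Sample.
Variables (R : realType) (M : nat).
Variables (d : measure_display) (T : measurableType d) (Pr : probability T R).
Variables (n : nat) (x : 'I_n -> T -> measurableTypeR R * measurableTypeR R).

(** The intersection over all indices has the form in which mutual independence
    computes its probability. *)
Definition avoids (S : {set bool * 'I_M}) : set T :=
  \bigcap_(i in [set` [set: 'I_n]%SET]) (x i @^-1` (~` @boxes R M S)).

(** Phrased by empty boxes, not by occupied ones, so that its complement is a
    union of events whose probabilities are known exactly. *)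
Definition dense_event : set T :=
  ~` \big[setU/set0]_(S : {set bool * 'I_M} | (M <= 2 * #|S|)%N) avoids S.

(** A pair of opposite boxes that is not fully occupied contributes an empty box
    to the set of empty boxes, which has fewer than M / 2 elements. *)
Lemma dense_event_occupied (w : T) : dense_event w ->
  exists J : {set 'I_M}, (M <= 2 * #|J|)%N /\
    forall b j, j \in J -> exists2 p, p \in sample_set x w & box M b j p.
Proof.
move=> Ew.
pose hit (s : bool * 'I_M) := `[< exists i, box M s.1 s.2 (x i w) >].
pose S := [set s | ~~ hit s]%SET.
have SM : (2 * #|S| < M)%N.
  rewrite ltnNge; apply/negP => MS; apply: Ew.
  rewrite (bigD1 S) //=; left => i _ /= /boxesP[s].
  by rewrite inE => /asboolPn sS sx; apply: sS; exists i.
pose J := ([set s.2 | s in S])%SET.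
exists (~: J)%SET; split.
  have JS : (#|J| <= #|S|)%N by exact: leq_imset_card.
  have JM : (#|J| + #|~: J|)%N = M by rewrite cardsC card_ord.
  by move: JS SM JM; move: #|J| #|S| #|~: J|%SET => a b c; lia.
move=> b j; rewrite inE => jJ.
have /asboolP[i bi] : hit (b, j).
  apply: contraNT jJ => bj; apply/imsetP; exists (b, j) => //.
  by rewrite inE.
by exists (x i w) => //; apply/imfsetP; exists i.
Qed.

Hypothesis M0 : (0 < M)%N.
Hypothesis xP : iid_unit_square_sample Pr x.

Lemma measurable_avoids S : measurable (avoids S).
Proof.
have [mx _ _] := xP; apply: fin_bigcap_measurable => // i _.
rewrite -[_ @^-1` _]setTI; apply: mx => //.
by apply: measurableC; exact: measurable_boxes.
Qed.

Lemma avoids_probability S :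
  Pr (avoids S) = ((1 - #|S|%:R * box_area R M) ^+ n)%:E.
Proof.
have [mx ix ux] := xP.
have mC : measurable (~` (@boxes R M S)).
  by apply: measurableC; exact: measurable_boxes.
have pr i : Pr (x i @^-1` (~` @boxes R M S)) =
    (1 - #|S|%:R * box_area R M)%:E.
  have mB : measurable (x i @^-1` @boxes R M S).
    by have := mx i measurableT _ (@measurable_boxes R M S); rewrite setTI.
  rewrite preimage_setC; apply: etrans (probability_setC _ mB) _.
  rewrite EFinB; congr (1 - _)%E.
  apply: etrans (ux i _ (@measurable_boxes R M S)) _.
  by rewrite setIidl; [exact: boxes_measure | exact: boxes_square].
rewrite /avoids ix //.
rewrite (eq_bigr (fun=> (1 - #|S|%:R * box_area R M)%:E)) => [|i _].
  by rewrite prodEFin prodr_const cardsT card_ord.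
exact: pr.
Qed.

(** Let a be the area of a box.  A set of c boxes with 2 c >= M is missed with
    probability (1 - c a) ^ n <= exp (- c a n) <= exp (- 4 M) <= 5 ^ (- M), and
    there are 4 ^ M sets of boxes. *)
Lemma dense_event_probability : 8 <= box_area R M * n%:R ->
  measurable dense_event /\ ((1 - (4 / 5) ^+ M)%:E <= Pr dense_event)%E.
Proof.
move=> an.
have e0 : 0 <= 5^-1 ^+ M :> R by rewrite exprn_ge0.
have bound (S : {set bool * 'I_M}) : (M <= 2 * #|S|)%N ->
    (Pr (avoids S) <= (5^-1 ^+ M)%:E)%E.
  move=> MS; rewrite avoids_probability lee_fin.
  have [a0 a1] := box_area_bounds R M0.
  have S2 : #|S|%:R <= 2 * M%:R :> R.
    rewrite -natrM ler_nat; apply: leq_trans (max_card _) _.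
    by rewrite card_prod card_bool card_ord.
  have S1 : M%:R <= 2 * #|S|%:R :> R by rewrite -natrM ler_nat.
  set z := #|S|%:R * box_area R M.
  have z1 : 0 <= 1 - z by rewrite subr_ge0 (le_trans _ a1) // ler_wpM2r.
  have ez : (1 - z) ^+ n <= expR (- z) ^+ n.
    by rewrite lerXn2r ?nnegrE ?expR_ge0 // expR_ge1Dx.
  apply: (le_trans ez); rewrite -expRM_natr.
  apply: (@le_trans _ _ (expR (- 4 * M%:R))).
    rewrite ler_expR /z !mulNr lerN2 -mulrA.
    apply: (@le_trans _ _ (#|S|%:R * 8)); first by lra.
    by rewrite ler_wpM2l.
  rewrite expRM_natr lerXn2r ?nnegrE ?expR_ge0 ?invr_ge0 // expRN.
  by rewrite lef_pV2 ?posrE ?expR_gt0 //; have := expR_ge1Dx (4 : R); lra.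
have [mU PU] := finite_union_bound (fun S _ => measurable_avoids S) bound e0.
split; first exact: measurableC.
rewrite probability_setC // EFinB leeB //.
apply: (le_trans PU); rewrite lee_fin.
rewrite -cardsT -powersetT card_powerset cardsT card_prod card_bool card_ord.
by rewrite natrX exprM -exprMn (_ : 2 ^+ 2 = 4) // -natrX.
Qed.

End Sample.

(** * Scaling with the sample size *)

Section Scale.
Variable R : realType.

Definition cube_root (n : nat) : R := n%:R `^ 3^-1.

(** The constant 40 makes the expected number of sample points in a box at
    least 8: the area of a box is 1 / (6912 M ^ 3). *)
Definition resolution (n : nat) : nat := Num.trunc (cube_root n / 40).

Lemma cube_rootK n : cube_root n ^+ 3 = n%:R.
Proof.
rewrite -powR_mulrn ?powR_ge0 // -powRrM mulVf ?pnatr_eq0 //.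
by rewrite powRr1.
Qed.

Lemma cube_root_ge0 n : 0 <= cube_root n.
Proof. exact: powR_ge0. Qed.

Lemma resolution_bounds n :
  40 * (resolution n)%:R <= cube_root n < 40 * (resolution n).+1%:R.
Proof.
have /truncn_itv/andP[] : 0 <= cube_root n / 40.
  by rewrite divr_ge0 ?cube_root_ge0.
rewrite -/(resolution n) => ? ?; apply/andP; split; lra.
Qed.

Lemma resolution_cvg : resolution n @[n --> \oo] --> \oo.
Proof.
apply/cvgnyPge => A; near=> n.
rewrite /resolution truncn_ge_nat ?divr_ge0 ?cube_root_ge0 //.
rewrite ler_pdivlMr // -(@ler_pXn2r _ 3) ?nnegrE ?mulr_ge0 ?cube_root_ge0 //.
rewrite cube_rootK -natrM -natrX ler_nat.
by near: n; exact: nbhs_infty_ge.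
Unshelve. all: by end_near. Qed.

Lemma resolution_area n : (0 < resolution n)%N ->
  8 <= box_area R (resolution n) * n%:R.
Proof.
move=> M0; have /andP[+ _] := resolution_bounds n; rewrite -cube_rootK.
rewrite /box_area /box_height /box_width.
have : 0 < (resolution n)%:R :> R by rewrite ltr0n.
move: (resolution n)%:R (cube_root n) => m q m0 mq.
have -> : (12 * m)^-1 * ((12 * m)^-1 ^+ 2 / 4) * q ^+ 3 =
    (q / (12 * m)) ^+ 3 / 4.
  by field; rewrite gt_eqF.
(* 10 / 3 is 40 / 12, and its cube exceeds 32 = 4 * 8. *)
have : 10 / 3 <= q / (12 * m) by rewrite ler_pdivlMr ?mulr_gt0 //; lra.
move: (q / _) => u u1; have u2 : 10 <= u ^+ 2 by nra.
by rewrite exprSr; nra.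
Qed.

Lemma resolution_exp2 (c k : nat) :
  \forall n \near \oo, (2 * (c * (resolution n).+1) ^ k <= 2 ^ resolution n)%N.
Proof.
have [N NP] := poly_le_exp2 (2 * c ^ k) k.
have := resolution_cvg => /cvgnyPge/(_ N); apply: filterS => n /NP.
by rewrite expnMn mulnA.
Qed.

(** After raising to the fourth power, the exponential becomes at most
    2 ^ (M + 1), where M is the resolution, and 2 ^ j at least 2 ^ (2 M); the
    factor X, at most n, costs a polynomial in M of degree 12. *)
Lemma sample_size_bound (n : nat) (X : nat) (j : nat) :
  (X <= n)%N -> (resolution n <= 2 * j)%N ->
  (2 * (40 * (resolution n).+1) ^ 12 <= 2 ^ resolution n)%N ->
  expR (ln 2 / 160 * X%:R `^ 3^-1) * X%:R <= 2 ^+ j :> R.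
Proof.
move=> Xn Mj; rewrite -(ler_nat R) natrM !natrX natrM => M12.
have ln2 : 0 < ln 2 :> R by rewrite ln_gt0 // ltr1n.
have /andP[_ qM] := resolution_bounds n.
have q0 := cube_root_ge0 n.
have Xq : X%:R `^ 3^-1 <= cube_root n.
  by rewrite ge0_ler_powR ?nnegrE ?invr_ge0 // ler_nat.
have X3 : X%:R <= cube_root n ^+ 3 by rewrite cube_rootK ler_nat.
rewrite -(@ler_pXn2r _ 4) ?nnegrE ?mulr_ge0 ?expR_ge0 ?exprn_ge0 //.
rewrite exprMn -expRM_natr -exprM.
set m := (resolution n).+1%:R in qM M12 *.
have E : expR (ln 2 / 160 * X%:R `^ 3^-1 * 4) <= 2 ^+ (resolution n).+1 :> R.
  rewrite -[X in X ^+ _](@lnK R) ?posrE // -expRM_natr ler_expR -/m.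
  move: Xq qM ln2 {M12}; set a := _ `^ _; set l := ln 2 => aq qm l0.
  have am : a <= 40 * m by lra.
  by have := ler_wpM2l (ltW l0) am; lra.
have E' : X%:R ^+ 4 <= (40 * m) ^+ 12.
  apply: (@le_trans _ _ ((cube_root n ^+ 3) ^+ 4)).
    by rewrite lerXn2r ?nnegrE ?exprn_ge0.
  by rewrite -exprM lerXn2r ?nnegrE // ?(le_trans q0) // ltW.
apply: (@le_trans _ _ (2 ^+ (resolution n).+1 * (40 * m) ^+ 12)).
  by apply: ler_pM; rewrite ?expR_ge0 ?exprn_ge0.
rewrite exprSr -mulrA.
apply: (@le_trans _ _ (2 ^+ resolution n * 2 ^+ resolution n)).
  by rewrite ler_wpM2l ?exprn_ge0.
rewrite -exprD ler_eXn2l ?ltr1n //; lia.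
Qed.

End Scale.

Theorem corollary1p7 (R : realType) (K : fieldType) :
  (exists (c : R) (n0 : nat), 0 < c /\
     forall (n : nat) (t : R) (G : sfunctor (sr_index R)),
       (n0 <= n)%N ->
       simplicial_model R G
         (realization_functor R
           (subdivision_rips (planar (circle_points t n)))) ->
       sf_finitely_presented K G ->
       ((expR (c * n%:R))%:E <= size_of R K G)%E)
  /\
  (exists C : R, 0 < C /\
     forall (d : nat -> measure_display) (T : forall n, measurableType (d n))
         (Pr : forall n, probability (T n) R)
         (x : forall n, 'I_n -> T n -> measurableTypeR R * measurableTypeR R),
       (forall n, iid_unit_square_sample (Pr n) (x n)) ->
       forall F : {fset (R * R)%type} -> sfunctor (sr_index R),
       (forall X : {fset (R * R)%type},
          simplicial_model R (F X)
            (realization_functor R (subdivision_rips (planar X))) /\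
          sf_finitely_presented K (F X)) ->
       inner_probability (Pr n)
         [set w : T n |
           ((expR (C * #|` sample_set (x n) w|%:R `^ 3^-1))%:E <=
              size_of R K (F (sample_set (x n) w)))%E]
         @[n --> \oo] --> 1%E).
Proof.
split.
  have [c [n0 [c0 cP]]] := circle_size_exponential R K.
  by exists c, n0; split => // n t G n0n GX _; exact: cP n0n GX.
exists (ln 2 / 160); split; first by rewrite divr_gt0 // ln_gt0 // ltr1n.
move=> d T Pr x xP F FP.
apply: (@squeeze_cvge _ _ _ _ (fun n => (1 - (4 / 5) ^+ resolution R n)%:E) _
  (fun=> 1%E)); last exact: cvg_cst.
  near=> n.
  have M0 : (0 < resolution R n)%N.
    near: n; have := @resolution_cvg R => /cvgnyPge; exact.
  have M12 : (2 * (40 * (resolution R n).+1) ^ 12 <= 2 ^ resolution R n)%N.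
    by near: n; exact: resolution_exp2.
  have [mD PD] := dense_event_probability M0 (xP n) (resolution_area M0).
  apply/andP; split; last first.
    apply: ub_ereal_sup => _ [E [mE _] <-]; exact: probability_le1.
  apply: (le_trans PD); apply: ereal_sup_ubound.
  exists (dense_event (resolution R n) (x n)) => //.
  split=> // w Dw /=; have [J [MJ JP]] := dense_event_occupied Dw.
  have [FX _] := FP (sample_set (x n) w).
  apply: (square_model_size M0 K FX JP).
    by clear M12; lia.
  apply: (sample_size_bound (n := n)) => //.
  by apply: leq_trans (leq_imfset_card _ _ _) _; rewrite -cardE card_ord.
apply/fine_cvgP; split; first by near=> n.
rewrite -[X in _ --> X]subr0; apply: cvgB; first exact: cvg_cst.
have /cvg_geometric : `|4 / 5 : R| < 1 by rewrite ger0_norm; lra.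
move=> /(_ 1) geo.
have := cvg_comp _ _ (@resolution_cvg R) geo.
by apply: cvg_trans; apply: near_eq_cvg; near=> n; rewrite /= mul1r.
Unshelve. all: by end_near. Qed.
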